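(* Let $T$ be a line trigraph in $\mathcal F$ that contains no odd prism. Then: (1) $T$ is either complete or has an even pair; (2) if $T$ is favorable, then $T$ has an even pair disjoint from its switchable component.
   Context: A trigraph $T$ consists of a finite set $V(T)$ and a map $\theta:\binom{V(T)}{2}\to\{-1,0,1\}$. Two distinct vertices $u,v$ are strongly adjacent if $\theta(uv)=1$, strongly antiadjacent if $\theta(uv)=-1$, and semiadjacent (a switchable pair) if $\theta(uv)=0$; they are adjacent if $\theta(uv)\in\{0,1\}$ and antiadjacent if $\theta(uv)\in\{0,-1\}$. $N(v)$ is the set of vertices adjacent to $v$. For $X\subseteq V(T)$, $T|X$ is the trigraph on $X$ with $\theta$ restricted, and $T\setminus X=T|(V(T)\setminus X)$; $T$ contains $H$ if $H$ is isomorphic to some $T|X$. A clique (strong clique) is a set of pairwise adjacent (strongly adjacent) vertices; $T$ is complete if $V(T)$ is a clique. The full realization of $T$ is the graph on $V(T)$ whose edges are the adjacent pairs. A path is a sequence of distinct vertices $p_1,\dots,p_k$ such that $p_i,p_j$ are adjacent when $|i-j|=1$ and antiadjacent when $|i-j|>1$; its length is $k-1$, even or odd accordingly. A hole of length $k\ge5$ consists of vertices $h_1,\dots,h_k$ with $h_i,h_j$ adjacent if $|i-j|\in\{1,k-1\}$ and antiadjacent otherwise; an antihole is an induced subtrigraph whose complement (adjacency function $-\theta$) is a hole. $T$ is Berge if it contains no hole of odd length and no antihole of odd length. A prism is an induced subtrigraph whose full realization consists of two vertex-disjoint triangles $\{a_1,a_2,a_3\}$, $\{b_1,b_2,b_3\}$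 and three vertex-disjoint paths $P_i$ from $a_i$ to $b_i$ with no other edges; it is odd if all three $P_i$ have odd length. An even pair of $T$ is a strongly antiadjacent pair $\{u,v\}$ such that every path from $u$ to $v$ in $T$ has even length. $\Sigma(T)$ is the graph on $V(T)$ whose edges are the switchable pairs of $T$; a switchable component is a connected component of $\Sigma(T)$ with at least two vertices. $\mathcal F$ is the class of Berge trigraphs $T$ such that: (1) $T$ has at most one switchable component, and it has at most two edges; (2) if the switchable component has exactly one edge $xy$, then $N(x)\cap N(y)=\emptyset$ (it is called small); (3) if it has two edges, with $v$ the vertex of degree two in $\Sigma(T)$ and $x,y$ its neighbours, then $v$ is strongly anticomplete to $V(T)\setminus\{v,x,y\}$, $x$ is strongly antiadjacent to $y$, and $N(x)\cap N(y)=\{v\}$ (it is called light). For $T\in\mathcal F$, $D$ denotes the vertex set of its switchable component ($D=\emptyset$ if $T$ has no switchable pair). A pair $\{u,v\}$ is disjoint from the switchable component if $\{u,v\}\cap D=\emptyset$. A trigraph $T\in\mathcal F$ is favorable if (1) $|V(T)|\ge5$; (2) $T$ has a strongly antiadjacent pair $\{u,v\}$ disjoint from $D$; and (3) if $D=\{x,y\}$ is small, then at least one of $V(T)\setminus(D\cup N(x))$, $V(T)\setminus(D\cup N(y))$ is not a clique. $T$ is a line trigraph if its full realization is the line graph of a bipartite graph and every clique of size at least $3$ in $T$ is a strong clique. *)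

(* Defs.v *)
From mathcomp Require Import all_boot.
Set Implicit Arguments. Unset Strict Implicit. Unset Printing Implicit Defensive.

(* theta values: Tstrong = 1, Tsemi = 0, Tanti = -1 *)
Inductive tri := Tstrong | Tsemi | Tanti.

Record trigraph := Trigraph {
  tV :> finType;
  theta : tV -> tV -> tri;
  theta_sym : forall u v, theta u v = theta v u }.

Section Trigraphs.
Variable T : trigraph.
Implicit Types (u v x y w : T) (S : {set T}) (p : seq T).

Definition stradj u v : bool :=
  (u != v) && (match theta u v with Tstrong => true | _ => false end).
Definition strant u v : bool :=
  (u != v) && (match theta u v with Tanti => true | _ => false end).
Definition semiadj u v : bool :=
  (u != v) && (match theta u v with Tsemi => true | _ => false end).
Definition adj u v : bool :=
  (u != v) && (match theta u v with Tanti => false | _ => true end).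
Definition antiadj u v : bool :=
  (u != v) && (match theta u v with Tstrong => false | _ => true end).

Definition N v : {set T} := [set u | adj v u].

Definition clique S : Prop := forall u v, u \in S -> v \in S -> u != v -> adj u v.
Definition strong_clique S : Prop :=
  forall u v, u \in S -> v \in S -> u != v -> stradj u v.
Definition complete : Prop := clique [set: T].

Definition nat_consec (i j : nat) : bool := (i.+1 == j) || (j.+1 == i).

Definition is_path p : Prop :=
  uniq p /\
  forall x y, x \in p -> y \in p -> x != y ->
    (nat_consec (index x p) (index y p) -> adj x y) /\
    (~~ nat_consec (index x p) (index y p) -> antiadj x y).

Definition path_length p : nat := (size p).-1.

Definition path_from_to p u v : Prop :=
  is_path p /\ head u p = u /\ last v p = v /\ p != [::].

Definition cyc_consec (k i j : nat) : bool :=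
  nat_consec i j || ((i == 0) && (j == k.-1)) || ((j == 0) && (i == k.-1)).

Definition is_hole p : Prop :=
  5 <= size p /\ uniq p /\
  forall x y, x \in p -> y \in p -> x != y ->
    (cyc_consec (size p) (index x p) (index y p) -> adj x y) /\
    (~~ cyc_consec (size p) (index x p) (index y p) -> antiadj x y).

(* antihole: the complement (theta negated) is a hole; adjacency in the
   complement is antiadjacency in T and vice versa *)
Definition is_antihole p : Prop :=
  5 <= size p /\ uniq p /\
  forall x y, x \in p -> y \in p -> x != y ->
    (cyc_consec (size p) (index x p) (index y p) -> antiadj x y) /\
    (~~ cyc_consec (size p) (index x p) (index y p) -> adj x y).

Definition Berge : Prop :=
  (forall p, is_hole p -> ~~ odd (size p)) /\
  (forall p, is_antihole p -> ~~ odd (size p)).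

Definition consec_in p x y : bool :=
  [&& x \in p, y \in p & nat_consec (index x p) (index y p)].

(* Odd prism: triangles {a1,a2,a3}, {b1,b2,b3}, paths P_i = a_i q_i b_i;
   the full realization of T|X (edges = adjacent pairs) consists exactly of
   the two triangles and the three paths; all P_i have odd length. *)
Definition has_odd_prism : Prop :=
  exists (a1 a2 a3 b1 b2 b3 : T) (q1 q2 q3 : seq T),
    let P1 := a1 :: rcons q1 b1 in
    let P2 := a2 :: rcons q2 b2 in
    let P3 := a3 :: rcons q3 b3 in
    let X := P1 ++ P2 ++ P3 in
    [/\ uniq X,
        forall x y, x \in X -> y \in X -> x != y ->
          (adj x y <->
             [|| (x \in [:: a1; a2; a3]) && (y \in [:: a1; a2; a3]),
                 (x \in [:: b1; b2; b3]) && (y \in [:: b1; b2; b3]),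
                 consec_in P1 x y, consec_in P2 x y | consec_in P3 x y]) &
        [/\ odd (path_length P1), odd (path_length P2) & odd (path_length P3)]].

(* line trigraph: full realization is the line graph of a bipartite graph
   (with sides 'I_n and 'I_m; vertices of T are injectively mapped to edges),
   and every clique of size >= 3 is a strong clique *)
Definition line_trigraph : Prop :=
  (exists (n m : nat) (e : T -> 'I_n * 'I_m), injective e /\
     forall u v, u != v ->
       (adj u v <-> ((e u).1 == (e v).1) || ((e u).2 == (e v).2))) /\
  (forall S, 3 <= #|S| -> clique S -> strong_clique S).

Definition sw : rel T := fun u v => semiadj u v.

Definition swcomp (C : {set T}) : Prop :=
  (exists x, C = [set y | connect sw x y]) /\ 1 < #|C|.

Definition sw_edges (C : {set T}) : {set {set T}} :=
  [set e : {set T} | [exists x in C, exists y, sw x y && (e == [set x; y])]].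

Definition in_F : Prop :=
  [/\ Berge,
      (forall C C', swcomp C -> swcomp C' -> C = C'),
      (forall C, swcomp C -> #|sw_edges C| <= 2),
      (forall C, swcomp C -> #|sw_edges C| = 1 ->
         forall x y, x \in C -> sw x y -> N x :&: N y = set0) &
      (forall C, swcomp C -> #|sw_edges C| = 2 ->
         forall v x y, v \in C -> sw v x -> sw v y -> x != y ->
           [/\ forall w, w \notin [set v; x; y] -> strant v w,
               strant x y &
               N x :&: N y = [set v]])].

(* D: vertex set of the switchable component (empty if none) *)
Definition Dset : {set T} := [set x | [exists y, sw x y]].

Definition favorable : Prop :=
  [/\ 5 <= #|T|,
      (exists u v, [&& strant u v, u \notin Dset & v \notin Dset]) &
      (forall x y, sw x y -> Dset = [set x; y] ->
         ~ clique (~: (Dset :|: N x)) \/ ~ clique (~: (Dset :|: N y)))].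

Definition even_pair u v : Prop :=
  strant u v /\ forall p, path_from_to p u v -> ~~ odd (path_length p).

End Trigraphs.

(* Main.v *)
Require Import Defs.
From mathcomp Require Import all_boot zify.
Set Implicit Arguments. Unset Strict Implicit. Unset Printing Implicit Defensive.

(** Let the full realization of [T] be the line graph of a bipartite graph [B].
A switchable pair is a pair of edges of [B] meeting at a vertex of degree two,
so the paths of [T] between strongly antiadjacent vertices are induced paths of
the full realization. Hence disjoint edges [ab] and [cd] of [B], with [a] and
[c] on the same side, form an even pair as soon as [B - {b, d}] has no path from
[a] to [c] and [B - {a, c}] has no path from [b] to [d].

Without an odd prism, three internally disjoint paths of [B] always join
vertices on opposite sides. Call a path [abcd] of [B] good if [ab] and [cd] form
such a pair. If [p y1 y2 y3 ..] starts one path of a theta and [p y1 y2 y3] is not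
good, then some ear leaves [y1] or [y2]; it cannot end on another path of the
theta, as one of the two branch vertices is on the side of its origin, so it
yields a theta with a shorter distinguished path. By induction every path of
length at least three of a theta contains a good path. A bad path [x0 x1 x2 x3]
of a cycle yields an ear, hence a theta with two long paths on the cycle.

Let [W] be the set of the vertices of [B] where switchable pairs meet: it has at
most two elements, they have degree two, and the edges incident to [W] are the
vertices of the switchable component. One of the two long paths above avoids
[W]; so if no good path avoids [W], then three consecutive vertices of any path of
length three avoiding [W] lie on a cycle of length four through a vertex of [W].
What remains is a connectivity argument in [B - W]. *)

(** * Duplicate-free lists and sets closed under a relation *)

Lemma uniq_count_leq (V : eqType) (l1 l2 : seq V) :
  (forall x, count_mem x l1 <= count_mem x l2) -> uniq l2 -> uniq l1.
Proof.
move=> le12 U2; apply/count_mem_uniq => x.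
have [x1|/count_memPn-> //] := boolP (x \in l1).
have := le12 x; rewrite (count_uniq_mem x U2).
by move: x1; rewrite -has_pred1 has_count; lia.
Qed.

Ltac count_lia :=
  rewrite -?cats1 /= ?(count_cat, count_rev) /= ?(count_cat, count_rev) /=
    ?(count_cat, count_rev) /=;
  repeat match goal with
  | |- context [nat_of_bool ?b] => generalize (nat_of_bool b)
  | |- context [count ?p ?l] => generalize (count p l)
  end; clear; lia.

(** Splitting, reversing and reordering pieces of a duplicate-free list, or dropping some, never
    raises a multiplicity; this is linear arithmetic on [count]. *)
Ltac uniq_from U := refine (uniq_count_leq _ U) => ?; count_lia.

Ltac bool_cases :=
  repeat match goal with
  | |- context [?a == ?b] => case: (a == b)
  | |- context [?a \in ?l] => case: (a \in l)
  end.

Lemma closed_disconnected (V : finType) (e : rel V) (P : {pred V}) u v :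
  (forall x y, x \in P -> e x y -> y \in P) -> u \in P -> v \notin P ->
  ~~ connect e u v.
Proof.
move=> clP uP; apply: contra => /connectP[s hs ->] {v}.
by elim: s u uP hs => //= x s IHs u uP /andP[/(clP _ _ uP)/IHs]; apply.
Qed.

(** * Thetas, good paths and good pairs in a bipartite graph *)

Section BipartiteGraph.
Variables (V : finType) (E : rel V) (side : V -> bool).
Hypothesis Esym : symmetric E.
Hypothesis Eside : forall u v, E u v -> side u != side v.

Lemma E_irr u : E u u = false.
Proof. by apply/negP => /Eside; rewrite eqxx. Qed.

Lemma sorted_rev l : sorted E (rev l) = sorted E l.
Proof. by rewrite rev_sorted; apply: eq_sorted => u v /=; rewrite Esym. Qed.

Lemma cycle_rev l : cycle E (rev l) = cycle E l.
Proof. by rewrite rev_cycle; apply: eq_cycle => u v /=; rewrite Esym. Qed.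

Lemma cycle_catC l1 l2 : cycle E (l1 ++ l2) = cycle E (l2 ++ l1).
Proof. by rewrite -(rot_cycle (size l1)) rot_size_cat. Qed.

Lemma path_rev p A q : sorted E (q :: rcons (rev A) p) = sorted E (p :: rcons A q).
Proof. by rewrite -sorted_rev rev_cons rev_rcons revK. Qed.

Lemma sorted_split l1 x l2 :
  sorted E (l1 ++ x :: l2) = sorted E (rcons l1 x) && sorted E (x :: l2).
Proof. by case: l1 => [|y l1] //=; rewrite cat_path rcons_path /= andbA. Qed.

Lemma sorted_side p A q :
  sorted E (p :: rcons A q) -> side q = side p (+) ~~ odd (size A).
Proof.
elim: A p => [|a A IH] p /=.
  by rewrite andbT => /Eside; case: (side p); case: (side q).
case/andP=> /Eside pa /IH ->.
by move: pa; case: (side p); case: (side a); case: (odd _).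
Qed.

(** An empty interior stands for the edge [pq]. Several interiors may be empty: the ends then lie on
    opposite sides anyway, so [theta_side] asks nothing extra of such a degenerate theta. *)
Definition is_theta p q A R S :=
  [/\ sorted E (p :: rcons A q), sorted E (p :: rcons R q),
      sorted E (p :: rcons S q) & uniq (p :: q :: A ++ R ++ S)].

Hypothesis theta_side : forall p q A R S, is_theta p q A R S -> side p != side q.

Lemma theta_rev p q A R S :
  is_theta p q A R S -> is_theta q p (rev A) (rev R) (rev S).
Proof.
by case=> hA hR hS U; split; rewrite ?path_rev //; uniq_from U.
Qed.

Lemma theta_swap p q A R S : is_theta p q A R S -> is_theta p q A S R.
Proof. by case=> hA hR hS U; split=> //; uniq_from U. Qed.

Lemma theta_rot p q A R S : is_theta p q A R S -> is_theta p q S A R.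
Proof. by case=> hA hR hS U; split=> //; uniq_from U. Qed.

(** The three paths from [y] to [z] are the stretch [M] cut off by the ear, the ear itself, and the
    way back to [p], along [R] to [q] and back to [z]. *)
Lemma theta_ear p q A1 y A2 R S M z N s :
  is_theta p q (A1 ++ y :: A2) R S -> rcons A2 q = M ++ z :: N ->
  sorted E (y :: rcons s z) -> uniq (s ++ p :: q :: (A1 ++ y :: A2) ++ R ++ S) ->
  is_theta y z M s (rev A1 ++ p :: R ++ rev N).
Proof.
move=> [hA hR hS _] eA hs U.
move: hA; rewrite rcons_cat rcons_cons -cat_cons sorted_split eA -cat_cons.
rewrite sorted_split => /and3P[h1 h2 h3].
have hN : sorted E (p :: R ++ rcons (rev N) z).
  (* [N] is empty exactly when the ear ends at [q]; otherwise its last entry is [q], and [rev N]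
     starts there. *)
  case/lastP: N eA h3 => [|N x].
    by rewrite cats1 => /rcons_inj[_ <-] _; rewrite cats1.
  rewrite -rcons_cons -rcons_cat => /rcons_inj[_ <-] h3.
  rewrite rev_rcons rcons_cons -cat_cons sorted_split rcons_cons hR /=.
  by rewrite -[path E q _]/(sorted E (q :: rcons (rev N) z)) path_rev.
have eU x : count_mem x A2 + (q == x) = count_mem x M + (z == x) + count_mem x N.
  by have := congr1 (count_mem x) eA; rewrite -cats1 !count_cat /=; lia.
split=> //.
- rewrite rcons_cat rcons_cons -cat_cons sorted_split rcons_cat hN andbT.
  by rewrite -[sorted E (rcons (y :: rev A1) p)]/(sorted E (y :: rcons (rev A1) p)) path_rev.
- by refine (uniq_count_leq _ U) => x; move: (eU x); count_lia.
Qed.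

(** As [p] and [q] are on opposite sides, [y] is on the side of one of them, say [q]. An ear to
    another path would join [y] to [q] along [A2], through [p] and [S], and through the ear and
    [R2]: a theta with ends on one side. *)
Lemma theta_fan p q A1 y A2 R1 z R2 S s :
  is_theta p q (A1 ++ y :: A2) (R1 ++ z :: R2) S -> sorted E (y :: rcons s z) ->
  ~~ uniq (s ++ p :: q :: (A1 ++ y :: A2) ++ (R1 ++ z :: R2) ++ S).
Proof.
wlog yq : p q A1 A2 R1 R2 S / side y = side q => [hw | ].
  have [/eqP|yq] := boolP (side y == side q); first exact: hw.
  move=> th hs; have pq := theta_side th.
  have := hw q p (rev A2) (rev A1) (rev R2) (rev R1) (rev S).
  have eqrev B1 x B2 : rev B2 ++ x :: rev B1 = rev (B1 ++ x :: B2) :> seq V.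
    by rewrite rev_cat rev_cons cat_rcons.
  rewrite !eqrev => hw'; have hyp : side y = side p.
    by move: pq yq; case: (side p); case: (side q); case: (side y).
  have := hw' hyp (theta_rev th) hs; apply: contra => U; uniq_from U.
move=> [hA hR hS _] hs; apply/negP => U.
suff: is_theta y q A2 (rev A1 ++ p :: S) (s ++ z :: R2).
  by move/theta_side; rewrite yq eqxx.
move: hA; rewrite rcons_cat rcons_cons -cat_cons sorted_split => /andP[h1 h2].
move: hR; rewrite rcons_cat rcons_cons -cat_cons sorted_split => /andP[h3 h4].
split=> //.
- rewrite rcons_cat rcons_cons -cat_cons sorted_split hS andbT.
  by rewrite -[sorted E (rcons (y :: rev A1) p)]/(sorted E (y :: rcons (rev A1) p)) path_rev.
- by rewrite rcons_cat rcons_cons -cat_cons sorted_split h4 andbT.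
- by uniq_from U.
Qed.

(** * Connections avoiding vertices, and good paths of a theta *)

Definition av (F : seq V) := [rel u v | [&& E u v, u \notin F & v \notin F]].

Definition good a b c d :=
  ~~ connect (av [:: b; d]) a c && ~~ connect (av [:: a; c]) b d.

Lemma av_sym F : symmetric (av F).
Proof. by move=> u v /=; rewrite Esym (andbC (u \notin F)). Qed.

Lemma av_csym F u v : connect (av F) u v = connect (av F) v u.
Proof. exact/sym_connect_sym/av_sym. Qed.

Lemma av_swap x y : connect (av [:: x; y]) =2 connect (av [:: y; x]).
Proof.
apply: eq_connect => u v /=; rewrite !inE (orbC (u == x)) (orbC (v == x)).
by [].
Qed.

Lemma good_rev a b c d : good a b c d = good d c b a.
Proof.
rewrite /good andbC [connect _ b d]av_csym [connect _ a c]av_csym.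
by congr (~~ _ && ~~ _); exact: av_swap.
Qed.

Lemma av_path F y s : path (av F) y s -> path E y s /\ all [predC F] s.
Proof.
by elim: s y => //= x s IHs y /andP[/and3P[-> _ ->] /IHs[-> ->]].
Qed.

(** This produces ears: the connection is made simple and cut at the first vertex of [Th] that it
    meets. *)
Lemma first_hit F y c (Th : seq V) :
  connect (av F) y c -> y \notin Th -> c \in Th ->
  exists s z, [/\ sorted E (y :: rcons s z), uniq (y :: s), z \in Th, z \notin F
                & all [predC Th] s].
Proof.
case/connectP=> s0 /shortenP[s hs Us _] -> {c} yTh cTh.
have hass : has [in Th] s.
  case: s {hs Us} cTh => [|x s] cTh; [by rewrite cTh in yTh |].
  by apply/hasP; exists (last x s); rewrite //= mem_last.
case: (split_find hass) hs Us => z s1 s2 zTh hs1.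
rewrite cat_path rcons_path => /andP[/andP[h1 h2] _] Us; exists s1, z; split=> //.
- rewrite /= rcons_path; case/and3P: h2 => -> _ _; rewrite andbT.
  by apply: sub_path h1 => u v /and3P[].
- by move: Us; rewrite -cat_cons cat_uniq -rcons_cons rcons_uniq => /andP[/andP[]].
- by case/and3P: h2.
- by rewrite all_predC.
Qed.


Definition good_P4 a b c d :=
  [/\ sorted E [:: a; b; c; d], uniq [:: a; b; c; d] & good a b c d].

Lemma theta_good p q A R S : is_theta p q A R S -> 1 < size A ->
  exists a b c d, good_P4 a b c d /\ {subset [:: a; b; c; d] <= p :: rcons A q}.
Proof.
have [k] := ubnP (size A); elim: k p q A R S => // k IHk p q A R S leAk th A_gt1.
(* [F] contains both neighbours of [y] on the first path, so an ear leaving [y] has to end elsewhere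
   on the theta. *)
have ear A1 y A2 c F : A = A1 ++ y :: A2 -> size A1 <= 1 ->
    last p A1 \in F -> head q A2 \in F -> c \in p :: q :: A1 ++ A2 ++ R ++ S ->
    connect (av F) y c ->
    exists a b c d, good_P4 a b c d /\ {subset [:: a; b; c; d] <= p :: rcons A q}.
  move=> defA szA1 F1 F2 cTh ync; rewrite {}defA in th leAk A_gt1 *.
  have [hA hR hS U] := th.
  have yTh : y \notin p :: q :: A1 ++ A2 ++ R ++ S.
    have : uniq (y :: p :: q :: A1 ++ A2 ++ R ++ S) by uniq_from U.
    by case/andP.
  have [s [z [hs Us zTh zF sTh]]] := first_hit ync yTh cTh.
  have Us' : uniq (s ++ p :: q :: (A1 ++ y :: A2) ++ R ++ S).
    rewrite cat_uniq U andbT; move: (Us); rewrite cons_uniq => /andP[ys us].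
    rewrite us has_sym -all_predC andTb.
    apply/allP => x xs /=.
    have /= := allP sTh x xs; have xy : x != y by apply: contraNneq ys => <-.
    by rewrite !inE !mem_cat !inE (negPf xy) -?orbA.
  have caseA2 : z \in rcons A2 q ->
      exists a b c d, good_P4 a b c d /\ {subset [:: a; b; c; d] <= p :: rcons (A1 ++ y :: A2) q}.
    move=> zA2; have [M [N def_A2]] : exists M N, rcons A2 q = M ++ z :: N.
      by case/splitPr: zA2 => M N; exists M, N.
    have th' := theta_ear th def_A2 hs Us'.
    have szM : size M + size N = size A2.
      by have := congr1 size def_A2; rewrite size_rcons size_cat /=; clear; lia.
    (* Size zero would end the ear at the successor of [y], which is in [F]; size one would put [y]
       and [z] on the same side. *)
    have M_gt1 : 1 < size M.
      have [hM _ _ _] := th'; have := theta_side th'; rewrite (sorted_side hM).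
      case: M def_A2 {hM th' szM} => [|m [|m' M]] // def_A2; last first.
        by rewrite /= addbF eqxx.
      have ez : z = head q A2 by case: (A2) def_A2 => [|x B] [].
      by rewrite ez F2 in zF.
    have ltM : size M < k.
      by move: leAk szM; rewrite size_cat /=; clear; lia.
    have [a [b [c' [d [h4 sub4]]]]] := IHk _ _ _ _ _ ltM th' M_gt1.
    exists a, b, c', d; split=> // x /sub4 xM.
    have subM : {subset rcons M z <= rcons A2 q}.
      by move=> u; rewrite def_A2 -cat_rcons mem_cat => ->.
    have : x \in y :: rcons A2 q.
      by move: xM; rewrite in_cons [in X in _ -> X]in_cons; case: eqP => //= _ /subM.
    by rewrite rcons_cat rcons_cons -cat_cons [in X in _ -> X]mem_cat => ->; rewrite orbT.
  have zR : z \notin R.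
    apply/negP => zR; case/splitPr: zR th Us' => R1 R2 th.
    exact/negP/theta_fan.
  have zS : z \notin S.
    apply/negP => zS; case/splitPr: zS th Us' => S1 S2 th Us'.
    have := theta_fan (theta_swap th) hs; rewrite -/(is_true _); case/negP.
    by uniq_from Us'.
  move: zTh; rewrite 2!inE !mem_cat (negPf zR) (negPf zS) !orbF.
  have [ez _|zq] := eqVneq z q; first by apply: caseA2; rewrite ez mem_rcons mem_head.
  have [zA2 _|zA2 /=] := boolP (z \in A2).
    by apply: caseA2; rewrite mem_rcons inE zA2 orbT.
  (* The ear ends at [p] or in [A1]. Since [F] excludes the predecessor of [y], this leaves [A1 =
     [:: y1]] and [z = p]. In the reversed theta the ear then cuts off [y1] alone, so that the new
     theta has ends on one side. *)
  rewrite orbF; move: szA1 F1 th Us' {hA U yTh cTh sTh leAk A_gt1 caseA2}.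
  case: A1 => [|y1 [|//]] _ /= F1 th Us'.
    by rewrite orbF => /eqP ez; rewrite ez F1 in zF.
  rewrite inE orbC; case/orP=> /eqP ez; first by rewrite ez F1 in zF.
  have := theta_rev th; rewrite /= !rev_cons -cats1 cat_rcons => th'.
  have := @theta_ear q p (rev A2) y [:: y1] (rev R) (rev S) [:: y1] p [::] s th' erefl.
  rewrite -ez => /(_ hs); rewrite ez => H.
  have : is_theta y p [:: y1] s (rev (rev A2) ++ q :: rev R ++ rev [::]).
    by apply: H; uniq_from Us'.
  move=> th2; have [h2 _ _ _] := th2; have := theta_side th2.
  by rewrite (sorted_side h2) /= addbF eqxx.
case: A A_gt1 leAk th ear => [|y1 [|y2 A]] //= _ leAk th ear.
have [hA hR hS U] := th.
have [gd|ngd] := boolP (good p y1 y2 (head q A)).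
  exists p, y1, y2, (head q A); split; first split=> //.
  - by move: hA; case: (A) => [|x B] /and4P[/= -> -> ->].
  - by move: U; case: (A) => [|x B] U; uniq_from U.
  - move=> x; rewrite !inE mem_rcons inE => /or4P[]/eqP->; rewrite ?eqxx ?orbT //.
    by case: (A) => [|x' B] /=; rewrite ?inE eqxx ?orbT.
(* The first way to fail gives an ear at [y2] avoiding [y1] and the successor of [y2], the second an
   ear at [y1] avoiding [p] and [y2]. *)
move: ngd; rewrite /good negb_and !negbK; case/orP=> [c1|c2].
- apply: (ear [:: y1] y2 A p [:: y1; head q A]); rewrite //= ?inE ?eqxx ?orbT //.
  by rewrite av_csym.
- apply: (ear [::] y1 (y2 :: A) (head q A) [:: p; y2]); rewrite //= ?inE ?eqxx ?orbT //.
  by case: (A) => [|x' B] /=; rewrite ?inE ?mem_cat ?inE eqxx ?orbT.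
Qed.

Lemma sides2 u v w : E u v -> E v w -> side u = side w.
Proof.
move=> /Eside uv /Eside; move: uv.
by case: (side u); case: (side v); case: (side w).
Qed.

(** The ear leaves [x2] and cannot end at [x0], for the path [x2 x1 x0] would belong to a theta with
    ends on one side. So it ends in [L], and the two arcs of the cycle are the long paths, the one
    through [x3] by parity. *)
Lemma cycle_ear x0 x1 x2 x3 L :
  cycle E [:: x0, x1, x2, x3 & L] -> uniq [:: x0, x1, x2, x3 & L] ->
  connect (av [:: x1; x3]) x0 x2 ->
  exists p q A R S, [/\ is_theta p q A R S, 1 < size A, 1 < size S &
    {subset (p :: rcons A q) ++ (p :: rcons S q) <= [:: x0, x1, x2, x3 & L]}].
Proof.
move=> hC U; rewrite av_csym => c20.
have [e01 e12 e23 hL] :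
  [/\ E x0 x1, E x1 x2, E x2 x3 & path E x3 (rcons L x0)] by case/and4P: hC.
have x2Th : x2 \notin [:: x0, x1, x3 & L].
  have : uniq [:: x2, x0, x1, x3 & L] by uniq_from U.
  by case/andP.
have [s [z [hs Us zTh zF sTh]]] := first_hit c20 x2Th (mem_head _ _).
have Us' : uniq (s ++ [:: x0, x1, x2, x3 & L]).
  rewrite cat_uniq U andbT; move: (Us); rewrite cons_uniq => /andP[ys us].
  rewrite us has_sym -all_predC andTb; apply/allP => x xs.
  have := allP sTh x xs; have xy : x != x2 by apply: contraNneq ys => <-.
  by rewrite /= !inE (negPf xy).
have [e21 e10] : E x2 x1 /\ E x1 x0 by split; rewrite Esym.
move: zF; rewrite 2!inE negb_or => /andP[/negPf z1 /negPf z3].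
move: zTh; rewrite 3!inE z3 z1 /=; case/orP=> [/eqP ez|].
  suff th : is_theta x2 x0 [:: x1] s (x3 :: L).
    by have := theta_side th; rewrite (sides2 e21 e10) eqxx.
  split; [by rewrite /= e21 e10 | by rewrite -ez | by rewrite /= e23 |].
  by uniq_from Us'.
move=> zL; case/splitPr: zL hL {x2Th z1 z3 sTh} hC U Us' => L1 L2.
rewrite rcons_cat rcons_cons cat_path /= => /and3P[hL1 eL1z hL2] hC U Us'.
have th : is_theta x2 z (x3 :: L1) s (x1 :: x0 :: rev L2).
  split=> //.
  - by rewrite /= rcons_path e23 hL1.
  - rewrite /= e21 e10 /=.
    by rewrite -[path _ _ _]/(sorted E (x0 :: rcons (rev L2) z)) path_rev.
  - by uniq_from Us'.
exists x2, z, (x3 :: L1), s, (x1 :: x0 :: rev L2); split=> //.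
- case: (L1) (th) => // {}th; have [h _ _ _] := th.
  by have := theta_side th; rewrite (sorted_side h) /= addbF eqxx.
- move=> x; rewrite !(inE, mem_cat, mem_rcons, mem_rev).
  by bool_cases.
Qed.

(** * Good paths avoiding [W] *)

Variable W : {pred V}.
Hypothesis Wdeg : forall w a b c, w \in W -> E w a -> E w b -> E w c -> ~~ uniq [:: a; b; c].
Hypothesis Wadj : forall w w', w \in W -> w' \in W -> w != w' -> E w w'.

(** Two nonempty interiors make the three neighbours of [p] on the theta distinct, even if [R] is
    empty and one of them is [q]. *)
Lemma theta_end p q A R S :
  is_theta p q A R S -> 0 < size A -> 0 < size S -> p \notin W.
Proof.
case: A => // a A; case: S => // s S [hA hR hS U] _ _; apply/negP => pW.
suff : uniq [:: a; head q R; s].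
  apply/negP/(Wdeg pW).
  - by case/andP: hA.
  - by case: (R) hR => [|r R'] /andP[].
  - by case/andP: hS.
by case: (R) U => [|r R'] U; uniq_from U.
Qed.

(** A vertex of [W] inside [A] has two neighbours on that path; a vertex of [W] inside [S] would be
    a third one by [Wadj]. *)
Lemma theta_avoid p q A R S : is_theta p q A R S -> 0 < size A -> 0 < size S ->
  all [predC W] (p :: rcons A q) || all [predC W] (p :: rcons S q).
Proof.
move=> th A0 S0; have pW := theta_end th A0 S0.
have qW : q \notin W by apply: theta_end (theta_rev th) _ _; rewrite size_rev.
rewrite /= !all_rcons /= pW qW /= !all_predC -negb_and.
apply/negP => /andP[/hasP[w wA wW] /hasP[w' wS w'W]].
case: th => hA hR hS U; case/splitPr: wA hA U => A1 A2.
rewrite rcons_cat rcons_cons -cat_cons sorted_split rcons_cons => /andP[h1 h2] U.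
case/splitPr: wS U {hS S0} => S1 S2 U.
have ww' : w != w'.
  have : uniq [:: w; w'] by uniq_from U.
  by rewrite /= inE andbT.
suff : uniq [:: last p A1; head q A2; w'].
  apply/negP/(Wdeg wW); last exact: Wadj.
  - by move: h1; rewrite /= rcons_path Esym => /andP[].
  - by case: (A2) h2 => [|x B] /andP[].
by case/lastP: (A1) U => [|B y]; rewrite ?last_rcons; case: (A2) => [|x B'] U; uniq_from U.
Qed.

Definition good_P4_avoid := exists a b c d, good_P4 a b c d /\ all [predC W] [:: a; b; c; d].

Lemma cycle_good_P4 x0 x1 x2 x3 L :
  cycle E [:: x0, x1, x2, x3 & L] -> uniq [:: x0, x1, x2, x3 & L] ->
  all [predC W] [:: x0; x1; x2; x3] -> good_P4_avoid.
Proof.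
(* Reversing the cycle exchanges the two connections that can spoil [good]. *)
wlog c02 : x0 x1 x2 x3 L / ~~ good x0 x1 x2 x3 -> connect (av [:: x1; x3]) x0 x2.
  move=> hw hC U hW; have [|c02] := boolP (connect (av [:: x1; x3]) x0 x2).
    by move=> c02; apply: hw hC U hW.
  apply: (hw x3 x2 x1 x0 (rev L)).
  - rewrite -good_rev {1}/good c02 /= negbK => c13; rewrite av_csym.
    by rewrite av_swap.
  - rewrite -[_ :: _]/(rev [:: x0; x1; x2; x3] ++ rev L) cycle_catC -rev_cat.
    by rewrite cycle_rev.
  - by uniq_from U.
  - by move: hW; rewrite /= => /and5P[-> -> -> ->].
move=> hC U hW; have [gd|/c02 {}c02] := boolP (good x0 x1 x2 x3).
  exists x0, x1, x2, x3; split=> //; split=> //; first by case/and4P: hC => /= -> -> ->.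
  by uniq_from U.
have [p [q [A [R [S [th A1 S1 sub]]]]]] := cycle_ear hC U c02.
case/orP: (theta_avoid th (ltnW A1) (ltnW S1)) => hav.
- have [a [b [c [d [gd sub4]]]]] := theta_good th A1.
  by exists a, b, c, d; split=> //; apply/allP => u /sub4 /(allP hav).
- have [a [b [c [d [gd sub4]]]]] := theta_good (theta_rot th) S1.
  by exists a, b, c, d; split=> //; apply/allP => u /sub4 /(allP hav).
Qed.

(** A simple path from [a] to [c] closes up with [b] to a cycle. If its second or its last but one
    vertex is outside [W], that vertex extends [a], [b], [c] to four consecutive vertices of the
    cycle outside [W]. Otherwise the two coincide: they lie on one side, while distinct vertices of
    [W] are adjacent. *)
Lemma blocked_P4_common_nbr a b c d :
  sorted E [:: a; b; c; d] -> uniq [:: a; b; c; d] ->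
  all [predC W] [:: a; b; c; d] -> connect (av [:: b; d]) a c ->
  good_P4_avoid \/ exists w, [/\ w \in W, E w a & E w c].
Proof.
move=> h4 U hW /connectP[p0 /shortenP[p /av_path[hp pF] Up _] ec] {p0}.
have [eab ebc] : E a b /\ E b c by case/and3P: h4.
have [aW bW cW _] : [/\ a \notin W, b \notin W, c \notin W & d \notin W].
  by case/and5P: hW.
have bp : b \notin p by apply/negP => /(allP pF) /=; rewrite inE eqxx.
case/lastP: p ec hp Up bp {pF} => [|p x]; rewrite ?last_rcons /= => ec.
  by move: U; rewrite ec /= !inE eqxx !orbT.
rewrite -{}ec => hp Up bp.
case: p hp Up bp => [|w p] hp Up bp.
  by have := Eside (_ : E a c); rewrite (sides2 eab ebc) eqxx; case/andP: hp => -> _ /(_ isT).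
have hC : cycle E (b :: a :: rcons (w :: p) c).
  rewrite -[cycle _ _]/(E b a && path E a (rcons (rcons (w :: p) c) b)).
  by rewrite rcons_path last_rcons Esym eab hp Esym ebc.
have UC : uniq (b :: a :: rcons (w :: p) c).
  rewrite cons_uniq [uniq _]Up inE negb_or bp !andbT.
  by have : uniq [:: b; a] by [uniq_from U]; rewrite /= inE andbT.
have [wW|wW] := boolP (w \in W); last first.
  left; apply: (@cycle_good_P4 c b a w p); last by rewrite /= aW bW cW wW.
    by move: hC; rewrite -[b :: _]/(rcons (b :: a :: w :: p) c) -cats1 cycle_catC.
  by uniq_from UC.
have [pW|pW] := boolP (last w p \in W); last first.
  case/lastP: p hp Up bp hC UC pW => [|p w']; first by rewrite wW.
  rewrite last_rcons => hp Up bp hC UC w'W.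
  left; apply: (@cycle_good_P4 a b c w' (rev (w :: p))); last by rewrite /= aW bW cW w'W.
    rewrite -[_ :: _]/([:: a; b] ++ _) cycle_catC -cycle_rev rev_cat.
    by move: hC; rewrite -[w' :: _]rev_rcons -[c :: _]rev_rcons revK.
  by uniq_from UC.
right; exists w; split=> //; first by rewrite Esym; case/andP: hp.
have ewc : E (last w p) c by move: hp; rewrite /= rcons_path => /and3P[].
suff -> : w = last w p by [].
apply/eqP; apply: contraT => /(Wadj wW pW)/Eside/negP[]; apply/eqP.
move: hp; rewrite /= => /andP[/Eside eaw _].
by move: (Eside ewc) eaw; rewrite -(sides2 eab ebc); case: (side a); case: (side w); case: (side _).
Qed.

Lemma P4_dichotomy a b c d :
  sorted E [:: a; b; c; d] -> uniq [:: a; b; c; d] ->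
  all [predC W] [:: a; b; c; d] ->
  good_P4_avoid \/ exists w, w \in W /\ (E w a /\ E w c \/ E w b /\ E w d).
Proof.
move=> h4 U hW; have [gd|] := boolP (good a b c d).
  by left; exists a, b, c, d.
rewrite negb_and !negbK => /orP[c02|c13].
  have [|[w [wW wa wc]]] := blocked_P4_common_nbr h4 U hW c02; first by left.
  by right; exists w; split=> //; left.
have [||||gd|[w [wW wa wc]]] := @blocked_P4_common_nbr d c b a.
- by rewrite -sorted_rev.
- by uniq_from U.
- by case/and5P: hW => /= -> -> -> ->.
- by rewrite av_csym av_swap.
- by left.
- by right; exists w; split=> //; right.
Qed.

(** * Pairs of disjoint edges and the connectivity argument *)

Definition edge_pair a b c d :=
  [/\ E a b, E c d, side a = side c & (a != c) && (b != d)].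

Definition good_pair_avoid := exists a b c d,
  [/\ edge_pair a b c d, good a b c d & all [predC W] [:: a; b; c; d]].

Lemma good_P4_pair : good_P4_avoid -> good_pair_avoid.
Proof.
move=> [a [b [c [d [[/and4P[ab bc cd _] U gd] hW]]]]].
exists a, b, c, d; split=> //; split=> //; first exact: sides2 ab bc.
have : uniq [:: a; c] by uniq_from U.
have : uniq [:: b; d] by uniq_from U.
by rewrite /= !inE !andbT => -> ->.
Qed.

Lemma edge_pair_uniq a b c d : edge_pair a b c d -> uniq [:: a; b; c; d].
Proof.
case=> /Eside ab /Eside cd acs /andP[ac bd]; rewrite /= !inE !negb_or ac bd !andbT -?andbA /=.
apply/and4P; split.
- by apply: contraNneq ab => ->.
- by apply: contraNneq cd => <-; rewrite acs.
- by apply: contraNneq ab => ->; rewrite acs.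
- by apply: contraNneq cd => ->.
Qed.

Lemma edge_pair_sym a b c d : edge_pair a b c d -> edge_pair c d a b.
Proof. by case=> ab cd acs /andP[ac bd]; split; rewrite // eq_sym ac eq_sym. Qed.

Lemma connect_av F u v : connect (av F) u v -> connect E u v.
Proof. by apply: connect_sub => x y /and3P[xy _ _]; apply: connect1. Qed.

Lemma disconnected_good a b c d :
  E a b -> E c d -> ~~ connect E a c -> good a b c d.
Proof.
move=> ab cd nac; apply/andP; split; apply: contra nac => /connect_av // bd.
apply: connect_trans (connect1 ab) (connect_trans bd _).
by rewrite (sym_connect_sym Esym) connect1.
Qed.

Lemma av_connect_notin F u v : u \notin F -> connect (av F) u v -> v \notin F.
Proof.
move=> uF; apply: contraL => vF; apply: (@closed_disconnected _ (av F) (predC (mem F))).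
- by move=> x y _ /and3P[].
- by rewrite inE.
- by rewrite inE negbK.
Qed.

Lemma component_nbr F a b u : E a b -> a \notin F -> b \notin F ->
  connect (av F) a u -> exists2 g, E g u & connect (av F) a g.
Proof.
move=> ab aF bF; rewrite av_csym => /connectP[[|g s] /=].
  by move=> _ <-; exists b; [rewrite Esym | apply: connect1; rewrite /= ab aF].
case/andP=> /and3P[ug _ _] hs ->; exists g; first by rewrite Esym.
by rewrite av_csym; apply/connectP; exists s.
Qed.

(** A simple path from [a] to [c] has even length, because they lie on one side. If it is longer
    than two, its first four vertices do; if it has length two, the edge [cd] or [ab] prolongs
    it. *)
Lemma connected_pair_P4 F a b c d :
  edge_pair a b c d -> all [predC F] [:: a; b; c; d] -> connect (av F) a c ->
  exists a' b' c' d', [/\ sorted E [:: a'; b'; c'; d'], uniq [:: a'; b'; c'; d']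
    & all [predC F] [:: a'; b'; c'; d']].
Proof.
move=> pr hF; have U := edge_pair_uniq pr; have [ab cd acs /andP[ac bd]] := pr.
case/connectP=> p0 /shortenP[p /av_path[hp pF] Up _] ec {p0}.
have aF : [predC F] a by case/andP: hF.
case: p hp pF Up ec => [|x1 [|x2 [|x3 p]]] /=.
- by move=> _ _ _ ec; rewrite ec eqxx in ac.
- by rewrite andbT => /Eside ax _ _ ec; rewrite -ec acs eqxx in ax.
- case/and3P=> ax1 x12 _ /and3P[x1F _ _] Up ec; subst x2.
  have [x1b|x1b] := eqVneq x1 b.
    by exists a, b, c, d; split=> //=; rewrite ab cd -x1b x12.
  exists b, a, x1, c; split.
  + by rewrite /= Esym ab ax1 x12.
  + have : uniq [:: a; x1; c] by [].
    have : uniq [:: b; a] by uniq_from U.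
    have : uniq [:: b; c] by uniq_from U.
    by rewrite /= !inE !negb_or !andbT (eq_sym b x1) x1b => -> -> /andP[/andP[-> ->] ->].
  + by case/and5P: hF => _ bF cF _ _; apply/and5P; split.
- case/and4P=> ax1 x12 x23 _ /and4P[x1F x2F x3F _] Up ec.
  exists a, x1, x2, x3; split; first by rewrite /= ax1 x12 x23.
  + have {}Up : uniq [:: a, x1, x2, x3 & p] := Up.
    by change (is_true (uniq [:: a; x1; x2; x3])); uniq_from Up.
  + by apply/and5P; split.
Qed.

(* The last case is a path [g s p q t h] whose end edges form the pair:
   [p] and [q] can only be crossed by [s p q t]. *)
Lemma barrier_good_pair p q s t a b c d :
  E p q -> (forall u, E p u -> u = q \/ u = s) -> (forall u, E q u -> u = p \/ u = t) ->
  (forall w, w \in W -> w \in [:: p; q]) ->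
  edge_pair a b c d -> all [predC [:: p; q]] [:: a; b; c; d] ->
  ~~ connect (av [:: p; q]) a c -> good_pair_avoid.
Proof.
set Z := [:: p; q] => pq Np Nq WZ pr hZ nac.
have hW x : x \notin Z -> x \notin W by apply: contra => /WZ.
have trivial_pair : ~~ connect E a c -> good_pair_avoid.
  move=> nE; exists a, b, c, d; split=> //.
    by case: pr => ab cd _ _; apply: disconnected_good.
  by apply/allP => x /(allP hZ) /hW.
have [ab cd acs /andP[ac bd]] := pr.
have [aZ bZ cZ dZ] : [/\ a \notin Z, b \notin Z, c \notin Z & d \notin Z].
  by case/and5P: hZ.
(* A component of the graph without [p] and [q] can only be left from [s] to [p] or from [t] to
   [q]. *)
have attached u v : u \notin Z -> v \notin Z -> ~~ connect (av Z) u v ->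
    connect E u v -> E p s && connect (av Z) u s || E q t && connect (av Z) u t.
  move=> uZ vZ nuv; apply: contraTT; rewrite negb_or !negb_and => /andP[us ut].
  have -> : connect E u v = connect (av [::]) u v by apply: eq_connect => x y /=; rewrite !andbT.
  apply: (@closed_disconnected _ (av [::]) (connect (av Z) u)); [|exact: connect0|exact: nuv].
  move=> x y ux /andP[xy _].
  have xZ := av_connect_notin uZ ux.
  have [yZ|yZ] := boolP (y \in Z); last first.
    by apply: connect_trans ux (connect1 _); rewrite /= xy xZ.
  move: yZ ux us ut xZ; rewrite !inE negb_or => /orP[]/eqP ey ux us ut /andP[xp xq].
    rewrite ey Esym in xy; have [ex|ex] := Np _ xy; first by rewrite ex eqxx in xq.
    by rewrite ex in ux xy; rewrite xy ux in us.
  rewrite ey Esym in xy; have [ex|ex] := Nq _ xy; first by rewrite ex eqxx in xp.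
  by rewrite ex in ux xy; rewrite xy ux in ut.
have [cE|/trivial_pair//] := boolP (connect E a c).
(* The components of [a] and [c] are distinct, so they are attached at different places; exchanging
   the edges, [a] reaches [s] and [c] reaches [t]. *)
wlog /andP[/andP[ps as_] /andP[qt ct]] : a b c d pr hZ nac trivial_pair ab cd acs ac bd
    aZ bZ cZ dZ cE / (E p s && connect (av Z) a s) && (E q t && connect (av Z) c t).
  move=> hw.
  have nca : ~~ connect (av Z) c a by rewrite av_csym.
  have cE' : connect E c a by rewrite (sym_connect_sym Esym).
  have nn x : connect (av Z) a x -> connect (av Z) c x -> false.
    by move=> ax cx; apply: contraNT nac => _; apply: connect_trans ax _; rewrite av_csym.
  have hw1 := hw a b c d pr hZ nac trivial_pair ab cd acs ac bd aZ bZ cZ dZ cE.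
  have hw2 : (E p s && connect (av Z) c s) && (E q t && connect (av Z) a t) -> good_pair_avoid.
    apply: (hw c d a b (edge_pair_sym pr) _ nca) => //.
    - by apply/and5P; split.
    - by rewrite cE'.
    - by rewrite eq_sym.
    - by rewrite eq_sym.
  have := attached a c aZ cZ nac cE; have := attached c a cZ aZ nca cE'.
  case/orP=> /andP[h1 h2] /orP[]/andP[h3 h4];
    by [case: (nn _ h4 h2) | apply: hw1; rewrite h1 h2 h3 h4 | apply: hw2; rewrite h1 h2 h3 h4].
have [g gs ag] := component_nbr ab aZ bZ as_.
have [h ht ch] := component_nbr cd cZ dZ ct.
have disj x y : connect (av Z) a x -> connect (av Z) c y -> x != y.
  move=> ax cy; apply: contraNneq nac => exy.
  by apply: connect_trans ax _; rewrite exy av_csym.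
have [sZ gZ tZ hhZ] : [/\ s \notin Z, g \notin Z, t \notin Z & h \notin Z].
  by split; [exact: av_connect_notin as_ | exact: av_connect_notin ag
    | exact: av_connect_notin ct | exact: av_connect_notin ch].
have step x y : connect (av Z) a x -> E x y -> y \notin Z -> connect (av Z) a y.
  move=> ax xy yZ; have xZ := av_connect_notin aZ ax.
  by apply: connect_trans ax (connect1 _); rewrite /= xy yZ xZ.
exists g, s, t, h; split; last by apply/and5P; split=> //; apply: hW.
  split=> //; first by rewrite Esym.
    by rewrite (sides2 gs (_ : E s p)) ?(sides2 pq qt) // Esym.
  by rewrite !disj.
(* The closed sets are the component of [a] without [s] for the first separation, and this component
   together with [p] and [q] for the second. *)
apply/andP; split.
- apply: (@closed_disconnected _ _ [pred x | connect (av Z) a x & x != s]).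
  + move=> x y /andP[ax xs] /and3P[xy xF yF].
    have ys : y != s by move: yF; rewrite !inE negb_or => /andP[].
    have xZ := av_connect_notin aZ ax.
    rewrite inE ys andbT; apply: (step _ _ ax xy); rewrite !inE negb_or.
    apply/andP; split; apply/eqP => ey; rewrite ey Esym in xy.
      by have [ex|ex] := Np _ xy; [rewrite ex !inE eqxx orbT in xZ | rewrite ex eqxx in xs].
    have [ex|ex] := Nq _ xy; first by rewrite ex !inE eqxx in xZ.
    by have := disj _ _ ax ct; rewrite ex eqxx.
  + by rewrite inE ag; apply: contraTneq gs => ->; rewrite E_irr.
  + by rewrite inE negb_and; apply/orP; left; apply: contraL (eqxx t) => /disj; apply.
- apply: (@closed_disconnected _ _ [pred x | connect (av Z) a x || (x \in Z)]).
  + move=> x y; rewrite inE => xX /and3P[xy _ yF]; rewrite inE.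
    have [yZ|yZ] := boolP (y \in Z); first by rewrite orbT.
    case/orP: xX => [ax|]; first by rewrite (step _ _ ax xy).
    rewrite !inE => /orP[]/eqP ex; rewrite ex in xy.
      by have [ey|->] := Np _ xy; [rewrite ey !inE eqxx orbT in yZ | rewrite as_].
    have [ey|ey] := Nq _ xy; first by rewrite ey !inE eqxx in yZ.
    by rewrite ey !inE eqxx orbT in yF.
  + by rewrite inE as_.
  + rewrite inE negb_or hhZ andbT; apply: contraL (eqxx h) => /disj; exact.
Qed.

Lemma disconnected_pair a b c d :
  edge_pair a b c d -> all [predC W] [:: a; b; c; d] -> ~~ connect E a c ->
  good_pair_avoid.
Proof.
move=> pr hW nac; exists a, b, c, d; split=> //.
by have [ab cd _ _] := pr; apply: disconnected_good.
Qed.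

Lemma good_pair_W0 a b c d :
  edge_pair a b c d -> W =i pred0 -> good_pair_avoid.
Proof.
move=> pr W0; have hall l : all [predC W] l by apply/allP => x _ /=; rewrite W0.
have [ac|] := boolP (connect (av [::]) a c).
  have [a' [b' [c' [d' [h4 U _]]]]] := @connected_pair_P4 [::] _ _ _ _ pr isT ac.
  have [/good_P4_pair//|[w []]] := P4_dichotomy h4 U (hall _).
  by rewrite W0.
have -> : connect (av [::]) a c = connect E a c by apply: eq_connect => x y /=; rewrite !andbT.
exact: disconnected_pair pr (hall _).
Qed.

(** Each of [p] and [q] has at most one neighbour outside [W], so neither is the common neighbour in
    [P4_dichotomy]. If [W] separates the two edges, [pq] is a barrier. *)
Lemma good_pair_W2 p q s t a b c d :
  E p q -> (forall u, E p u -> u = q \/ u = s) -> (forall u, E q u -> u = p \/ u = t) ->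
  W =i [:: p; q] -> edge_pair a b c d -> all [predC W] [:: a; b; c; d] ->
  good_pair_avoid.
Proof.
move=> pq Np Nq Wpq pr hW.
have hZ : all [predC [:: p; q]] [:: a; b; c; d].
  by apply/allP => x /(allP hW) /=; rewrite Wpq.
have [|nac] := boolP (connect (av [:: p; q]) a c); last first.
  by apply: (barrier_good_pair pq Np Nq _ pr hZ nac) => w; rewrite Wpq.
move/(connected_pair_P4 pr hZ) => [a' [b' [c' [d' [h4 U hZ']]]]].
have hW' : all [predC W] [:: a'; b'; c'; d'].
  by apply/allP => x /(allP hZ') /=; rewrite Wpq.
have [/good_P4_pair//|[w [wW]]] := P4_dichotomy h4 U hW'.
have one x y : x != y -> x \notin W -> y \notin W -> E w x -> E w y -> False.
  rewrite !Wpq !inE !negb_or => xy /andP[/eqP xp /eqP xq] /andP[/eqP yp /eqP yq].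
  move: wW; rewrite Wpq !inE => /orP[]/eqP->.
    by move=> /Np[|ex] // /Np[|ey] //; rewrite ex ey eqxx in xy.
  by move=> /Nq[|ex] // /Nq[|ey] //; rewrite ex ey eqxx in xy.
have [aW bW cW dW] : [/\ a' \notin W, b' \notin W, c' \notin W & d' \notin W].
  by case/and5P: hW'.
have ac : uniq [:: a'; c'] by uniq_from U.
have bd : uniq [:: b'; d'] by uniq_from U.
move: ac bd; rewrite /= !inE !andbT => ac bd.
by case=> [] []; [move/(one _ _ ac aW cW) | move/(one _ _ bd bW dW)] => h /h.
Qed.

(** A path avoiding [w] and [t] contains at most one neighbour of [w], which settles the connected
    case. Otherwise [wt] is a barrier, unless [t] has two neighbours besides [w]. *)
Lemma good_pair_W1 w s t a b c d :
  E w t -> (forall u, E w u -> u = s \/ u = t) -> W =i pred1 w ->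
  edge_pair a b c d -> all [predC [:: w; t]] [:: a; b; c; d] ->
  good_pair_avoid.
Proof.
move=> wt Nw Ww pr hZ; set Z := [:: w; t] in hZ *.
have hW x : x \notin Z -> x \notin W.
  by rewrite Ww !inE negb_or => /andP[].
have wW : w \in W by rewrite Ww inE.
have [|nac] := boolP (connect (av Z) a c).
  move/(connected_pair_P4 pr hZ) => [a' [b' [c' [d' [h4 U hZ']]]]].
  have hW' : all [predC W] [:: a'; b'; c'; d'].
    by apply/allP => x /(allP hZ') /hW.
  have [/good_P4_pair//|[w' [w'W]]] := P4_dichotomy h4 U hW'.
  have -> : w' = w by move: w'W; rewrite Ww => /eqP.
  have one x y : x != y -> x \notin Z -> y \notin Z -> E w x -> E w y -> False.
    rewrite !inE !negb_or => xy /andP[_ /eqP xt] /andP[_ /eqP yt].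
    by move=> /Nw[ex|] // /Nw[ey|] //; rewrite ex ey eqxx in xy.
  have [aZ bZ cZ dZ] : [/\ a' \notin Z, b' \notin Z, c' \notin Z & d' \notin Z].
    by case/and5P: hZ'.
  have ac : uniq [:: a'; c'] by uniq_from U.
  have bd : uniq [:: b'; d'] by uniq_from U.
  move: ac bd; rewrite /= !inE !andbT => ac bd.
  by case=> [] []; [move/(one _ _ ac aZ cZ) | move/(one _ _ bd bZ dZ)] => h /h.
have hWZ x : x \in W -> x \in Z by rewrite Ww !inE => ->.
have Nw' u : E w u -> u = t \/ u = s by case/Nw; auto.
have [/existsP[r1 /existsP[r2]]|no2] :=
    boolP [exists r1, exists r2, [&& E t r1, E t r2, r1 != w, r2 != w & r1 != r2]]; last first.
  have [/existsP[t' /andP[tt' t'w]]|no1] := boolP [exists t', E t t' && (t' != w)].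
    apply: (barrier_good_pair wt Nw' (t := t') _ hWZ pr hZ nac) => u tu.
    have [->|uw] := eqVneq u w; [by left | right].
    apply/eqP; apply: contraNT no2 => ut'; apply/existsP; exists u; apply/existsP; exists t'.
    by rewrite tu tt' uw t'w.
  (* Here [t] has no neighbour but [w], which also fills the place of the second one. *)
  apply: (barrier_good_pair wt Nw' (t := w) _ hWZ pr hZ nac) => u tu; left.
  by apply/eqP; apply: contraNT no1 => uw; apply/existsP; exists u; rewrite tu.
case/and5P=> tr1 tr2 r1w r2w r12.
(* The edges lie in different components outside [w] and [t], and one of these misses [s]. *)
wlog nsc : a b c d pr hZ nac / ~~ connect (av Z) c s.
  move=> hw; have nca : ~~ connect (av Z) c a by rewrite av_csym.
  have [cs|] := boolP (connect (av Z) c s); last exact: hw pr hZ nac.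
  apply: (hw c d a b (edge_pair_sym pr) _ nca).
    by case/and5P: hZ => aZ bZ cZ dZ _; apply/and5P; split.
  apply: contra nac => as_; apply: connect_trans as_ _; by rewrite av_csym.
have [ab cd acs /andP[ac bd]] := pr.
have [aZ bZ cZ dZ] : [/\ a \notin Z, b \notin Z, c \notin Z & d \notin Z].
  by case/and5P: hZ.
have [/existsP[c0 /andP[tc0 cc0]]|noc0] := boolP [exists c0, E t c0 && connect (av Z) c c0].
  have [h ht ch] := component_nbr cd cZ dZ cc0.
  (* The path [r t c0 h] avoids [w], and [w] is adjacent to neither [c0] nor [h], so [P4_dichotomy]
     leaves only a good path. *)
  have [r [tr rw rc0]] : exists r, [/\ E t r, r != w & r != c0].
    by have [e|] := eqVneq r1 c0; [exists r2; rewrite tr2 r2w eq_sym -e | exists r1].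
  have c0Z := av_connect_notin cZ cc0; have hhZ := av_connect_notin cZ ch.
  have [c0w c0t] : c0 != w /\ c0 != t by move: c0Z; rewrite !inE negb_or => /andP.
  have [hw ht'] : h != w /\ h != t by move: hhZ; rewrite !inE negb_or => /andP.
  have c0s : c0 != s by apply: contraNneq nsc => <-.
  have hs : h != s by apply: contraNneq nsc => <-.
  have pr' : edge_pair r t c0 h.
    split; rewrite ?rc0 1?[t == h]eq_sym ?ht' //; try by rewrite Esym.
    by apply: (@sides2 _ t); rewrite // Esym.
  have h4 : sorted E [:: r; t; c0; h] by rewrite /= Esym tr tc0 Esym ht.
  have hW' : all [predC W] [:: r; t; c0; h].
    rewrite /= !Ww !inE rw c0w hw !andbT /=; apply: contraTneq wt => ->.
    by rewrite E_irr.
  have [/good_P4_pair//|[w' [w'W]]] := P4_dichotomy h4 (edge_pair_uniq pr') hW'.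
  have -> : w' = w by move: w'W; rewrite Ww => /eqP.
  by case=> [] [_ /Nw[]e]; rewrite e eqxx in c0s c0t hs ht'.
(* Neither [w] nor [t] has a neighbour in the component of [c], so it is a component of the whole
   graph. *)
apply: (disconnected_pair pr); first by apply/allP => x /(allP hZ) /hW.
have -> : connect E a c = connect (av [::]) c a.
  by rewrite av_csym; apply: eq_connect => x y /=; rewrite !andbT.
apply: (@closed_disconnected _ (av [::]) (connect (av Z) c));
  [|exact: connect0|by rewrite inE av_csym].
move=> x y cx /andP[xy _]; have xZ := av_connect_notin cZ cx.
have [yZ|yZ] := boolP (y \in Z); last first.
  by apply: connect_trans cx (connect1 _); rewrite /= xy xZ.
move: yZ; rewrite !inE => /orP[]/eqP ey; rewrite ey Esym in xy.
  have [ex|ex] := Nw _ xy; first by case/negP: nsc; rewrite -ex.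
  by rewrite ex !inE eqxx orbT in xZ.
by case/existsP: noc0; exists x; rewrite xy.
Qed.

Lemma W_two_nbrs w q : w \in W -> E w q ->
  exists s, forall u, E w u -> u = q \/ u = s.
Proof.
move=> wW wq; have [/existsP[s /andP[ws sq]]|no] := boolP [exists s, E w s && (s != q)].
  exists s => u wu; have := Wdeg wW wu wq ws.
  rewrite /= !inE (eq_sym q) sq !andbT negb_or negb_and !negbK.
  by case/orP=> /eqP; [left | right].
exists q => u wu; left; apply/eqP; apply: contraNT no => uq.
by apply/existsP; exists u; rewrite wu.
Qed.

End BipartiteGraph.

(** * The root graph of a line trigraph *)

Section RootGraph.
Variables (T : trigraph) (n m : nat) (e : T -> 'I_n * 'I_m).
Hypothesis e_inj : injective e.
Hypothesis e_adj : forall u v, u != v ->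
  (adj u v <-> ((e u).1 == (e v).1) || ((e u).2 == (e v).2)).
Implicit Types (t x y z : T) (u v w : 'I_n + 'I_m).

Definition lv t : 'I_n + 'I_m := inl (e t).1.
Definition rv t : 'I_n + 'I_m := inr (e t).2.
Definition inc v t := (v == lv t) || (v == rv t).
Definition side (v : 'I_n + 'I_m) := if v is inl _ then true else false.
Definition root_adj : rel ('I_n + 'I_m) :=
  fun u v => (u != v) && [exists t, inc u t && inc v t].

Lemma root_adj_sym : symmetric root_adj.
Proof.
move=> u v; rewrite /root_adj eq_sym; congr (_ && _).
by apply: eq_existsb => t; rewrite andbC.
Qed.

Lemma root_adjP u v :
  reflect (u != v /\ exists t, inc u t /\ inc v t) (root_adj u v).
Proof.
apply: (iffP andP) => [[uv /existsP[t /andP[]]]|[uv [t [ut vt]]]].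
  by split=> //; exists t.
by split=> //; apply/existsP; exists t; rewrite ut.
Qed.

Lemma inc_side u v t : inc u t -> inc v t -> side u = side v -> u = v.
Proof. by move=> /orP[]/eqP-> /orP[]/eqP->. Qed.

Lemma root_adj_side u v : root_adj u v -> side u != side v.
Proof.
case/root_adjP=> uv [t [ut vt]]; apply: contraNneq uv => suv.
by rewrite (inc_side ut vt suv).
Qed.

Lemma inc3 u v w t : inc u t -> inc v t -> inc w t -> u != v -> w = u \/ w = v.
Proof.
by move=> /orP[]/eqP-> /orP[]/eqP-> /orP[]/eqP->; rewrite ?eqxx //; auto.
Qed.

(** The root graph has no parallel edges because [e] is injective. *)
Lemma inc_inj u v x y : u != v -> inc u x -> inc v x -> inc u y -> inc v y -> x = y.
Proof.
move=> uv; have ends t : inc u t -> inc v t ->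
    (lv t, rv t) = if side u then (u, v) else (v, u).
  by move=> /orP[]/eqP eu /orP[]/eqP ev; rewrite eu ev //= in uv *; rewrite eqxx in uv.
move=> ux vx uy vy; have := ends y uy vy; rewrite -(ends x ux vx) => -[e1 e2].
by apply: e_inj; rewrite [e x]surjective_pairing -e1 -e2 -surjective_pairing.
Qed.

Lemma adj_inc x y : x != y -> reflect (exists v, inc v x /\ inc v y) (adj x y).
Proof.
move=> xy; apply: (iffP idP) => [/(e_adj xy)/orP[]/eqP ex|[v [vx vy]]].
- by exists (lv x); rewrite /inc eqxx /lv ex eqxx.
- by exists (rv x); rewrite /inc eqxx /rv ex eqxx !orbT.
by apply/e_adj => //; move: vx vy => /orP[]/eqP-> /orP[]/eqP // [->]; rewrite eqxx ?orbT.
Qed.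

Lemma adj_neq x y : adj x y -> x != y.
Proof. by case/andP. Qed.

Lemma adjC x y : adj x y = adj y x.
Proof. by rewrite /adj eq_sym theta_sym. Qed.

Lemma antiadj_strant x y : x != y -> ~~ adj x y -> strant x y.
Proof. by rewrite /adj /strant => ->; case: theta. Qed.

Lemma strant_adj x y : strant x y -> (x != y) && ~~ adj x y.
Proof. by rewrite /adj /strant; case: (x != y); case: theta. Qed.

Lemma edge_ends t u v : u != v -> inc u t -> inc v t -> root_adj u v.
Proof. by move=> uv ut vt; apply/root_adjP; split=> //; exists t. Qed.

Lemma edge_pair_of x y : x != y -> ~~ adj x y ->
  edge_pair root_adj side (lv x) (rv x) (lv y) (rv y).
Proof.
move=> xy nxy; have end_adj t : root_adj (lv t) (rv t).
  by apply: (@edge_ends t); rewrite /inc ?eqxx ?orbT.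
split=> //; apply/andP; split; apply: contra nxy => /eqP ev; apply/adj_inc => //.
- by exists (lv x); rewrite /inc; split; [|rewrite ev]; rewrite eqxx.
- by exists (rv x); rewrite /inc; split; [|rewrite ev]; rewrite eqxx orbT.
Qed.

Lemma edge_pairE a b c d : edge_pair root_adj side a b c d ->
  exists x y, [/\ inc a x, inc b x, inc c y & inc d y] /\ strant x y.
Proof.
move=> pr; have U := edge_pair_uniq root_adj_side pr.
have [/root_adjP[ab [x [ax bx]]] /root_adjP[cd [y [cy dy]]] _ _] := pr.
exists x, y; split=> //; have nxy v : inc v x -> inc v y -> False.
  move=> vx vy; have [ev|ev] := inc3 ax bx vx ab; have [ev'|ev'] := inc3 cy dy vy cd;
    by move: U; rewrite /= !inE -?ev -?ev' eqxx ?orbT ?andbF.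
have xy : x != y by apply/eqP => exy; apply: (nxy a); rewrite // -exy.
by apply: antiadj_strant => //; apply/negP => /(adj_inc xy)[v [/nxy]].
Qed.

(** * Switchable pairs and paths of the trigraph *)

Hypothesis clique3_strong :
  forall S : {set T}, 3 <= #|S| -> clique S -> strong_clique S.

Lemma star3_stradj v x y z : inc v x -> inc v y -> inc v z ->
  x != y -> y != z -> x != z -> stradj x y.
Proof.
move=> vx vy vz xy yz xz; have vadj t t' : inc v t -> inc v t' -> t != t' -> adj t t'.
  by move=> vt vt' tt'; apply/adj_inc => //; exists v.
have all_v t : t \in [set x; y; z] -> inc v t.
  by rewrite !inE -orbA => /or3P[]/eqP->.
apply: (clique3_strong (S := [set x; y; z])) => //; rewrite ?inE ?eqxx ?orbT //.
- by rewrite -setUA cardsU1 cards2 !inE negb_or xy yz xz.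
- by move=> t t' /all_v vt /all_v vt'; apply: vadj.
Qed.

(** A third edge at the vertex shared by [x] and [y] would make them strongly adjacent. So [a] and
    [b] meet [x] at its other end, where the three form a strong clique. *)
Lemma semi_nbrs_stradj x y a b :
  adj x y -> ~~ stradj x y -> adj x a -> adj x b ->
  a != y -> b != y -> a != b -> stradj a b.
Proof.
move=> xy nxy xa xb ay by_ ab.
have [nxyE xaE xbE] := And3 (adj_neq xy) (adj_neq xa) (adj_neq xb).
have [w [wx wy]] := adj_inc nxyE xy.
have other c : adj x c -> c != y -> exists2 v, inc v x & inc v c /\ v != w.
  move=> xc cy; have xcE := adj_neq xc; have [v [vx vc]] := adj_inc xcE xc.
  exists v => //; split=> //; apply: contraNneq nxy => ev; rewrite ev in vc.
  by apply: (star3_stradj wx wy vc) => //; rewrite eq_sym.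
have [v vx [va vw]] := other a xa ay; have [v' v'x [v'b v'w]] := other b xb by_.
have wv : w != v by rewrite eq_sym.
have [ev|ev] := inc3 wx vx v'x wv.
  by rewrite ev eqxx in v'w.
rewrite ev in v'b; apply: (star3_stradj va v'b vx) => //; by rewrite eq_sym.
Qed.

Lemma path_nth_adj t0 p i : is_path p -> i.+1 < size p ->
  adj (nth t0 p i) (nth t0 p i.+1).
Proof.
move=> [Up hp] ip; have ip' := ltnW ip.
have [|h _] := hp _ _ (mem_nth t0 ip') (mem_nth t0 ip).
  by rewrite nth_uniq // neq_ltn ltnSn.
by apply: h; rewrite !index_uniq // /nat_consec eqxx.
Qed.

Lemma path_nth_antiadj t0 p i j : is_path p -> i.+1 < j -> j < size p ->
  antiadj (nth t0 p i) (nth t0 p j).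
Proof.
move=> [Up hp] ij jp; have ip : i < size p := ltn_trans (ltnW ij) jp.
have [|_ h] := hp _ _ (mem_nth t0 ip) (mem_nth t0 jp).
  by rewrite nth_uniq // neq_ltn (ltnW ij).
by apply: h; rewrite !index_uniq // /nat_consec; move: ij; clear; lia.
Qed.

Lemma antiadj_nstradj x y : antiadj x y -> ~~ stradj x y.
Proof. by rewrite /antiadj /stradj; case: (x != y) => //=; case: theta. Qed.

(* An adjacent nonconsecutive pair of a path would be switchable; its member
   which is not an end of the path would then have two antiadjacent
   neighbours forming a triangle with it. *)
Lemma path_nth_nadj t0 p i j : is_path p ->
  ~~ adj (nth t0 p 0) (nth t0 p (size p).-1) ->
  i.+1 < j -> j < size p -> ~~ adj (nth t0 p i) (nth t0 p j).
Proof.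
move=> hp nend ij jp; have [Up _] := hp; apply/negP => aij.
have nij := antiadj_nstradj (path_nth_antiadj t0 hp ij jp).
case: i ij aij nij => [|i] ij aij nij.
  have jl : j.+1 < size p.
    have : j != (size p).-1 by apply: contraNneq nend => <-.
    by move: jp; clear; case: (size p) => // k; rewrite ltnS leq_eqVlt; case: eqP.
  case: j ij aij nij jp jl => [//|j] ij aij nij jp jl.
  have ns := antiadj_nstradj (path_nth_antiadj t0 hp (ltnSn j.+1) jl).
  have [p0 j0 jp'] : [/\ 0 < size p, j != 0 & j < size p].
    by split; [exact: leq_ltn_trans jl | rewrite -lt0n | exact: ltnW].
  have jj : j != j.+2 by rewrite ltn_eqF // ltnW.
  case/negP: ns; apply: (@semi_nbrs_stradj (nth t0 p j.+1) (nth t0 p 0));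
    rewrite ?nth_uniq //.
  - by rewrite adjC.
  - by move: nij; rewrite /stradj eq_sym theta_sym.
  - by rewrite adjC; apply: path_nth_adj.
  - exact: path_nth_adj.
have il : i.+2 < size p by exact: ltn_trans jp.
have ip := ltnW (ltnW il).
have ns := antiadj_nstradj (path_nth_antiadj t0 hp (ltnSn i.+1) il).
have [ii ij1 ij2] : [/\ i != i.+2, i != j & i.+2 != j].
  by rewrite (ltn_eqF ij) (ltn_eqF (ltnW (ltnW ij))) (ltn_eqF (leqnSn i.+1)).
case/negP: ns; apply: (@semi_nbrs_stradj (nth t0 p i.+1) (nth t0 p j));
  rewrite ?nth_uniq //.
- by rewrite adjC; apply: path_nth_adj (ltnW il).
- exact: path_nth_adj.
Qed.

(** Consecutive vertices of a path of [T] share a vertex of the root graph, and successive shared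
    vertices are adjacent there. Each step of this walk changes sides, and no shared vertex is in
    [F]. *)
Lemma shared_vertex_walk (F : seq ('I_n + 'I_m)) (t0 x0 x1 : T) (s : seq T) u :
  path (@adj T) x0 (x1 :: s) ->
  path (fun x y => ~~ has (fun v => inc v x && inc v y) F) x0 (x1 :: s) ->
  (forall i j v, i.+1 < j -> j < (size s).+2 ->
     inc v (nth t0 [:: x0, x1 & s] i) -> inc v (nth t0 [:: x0, x1 & s] j) -> False) ->
  inc u x0 -> inc u x1 ->
  exists v, [/\ inc v (nth t0 [:: x0, x1 & s] (size s)), inc v (last x1 s),
    side v = side u (+) odd (size s) & connect (av root_adj F) u v].
Proof.
elim: s x0 x1 u => [|x2 s IHs] x0 x1 u.
  by move=> _ _ _ u0 u1; exists u; rewrite addbF connect0.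
move=> /andP[a01 /andP[a12 hs]] /andP[n01 /andP[n12 hF]] dis u0 u1.
have [w [w1 w2]] := adj_inc (adj_neq a12) a12.
have uw : u != w.
  by apply/eqP => uw; apply: (dis 0 2 u) => //=; rewrite uw.
have uF : u \notin F by apply: contra n01 => uF; apply/hasP; exists u; rewrite ?u0.
have wF : w \notin F by apply: contra n12 => wF; apply/hasP; exists w; rewrite ?w1.
have euw := edge_ends uw u1 w1.
have [||i j v ij js|z [zi zl sz cz]] := IHs x1 x2 w _ _ _ w1 w2.
- by rewrite /= a12.
- by rewrite /= n12.
- by apply: (dis i.+1 j.+1).
exists z; split=> //.
- by rewrite sz /=; move: (root_adj_side euw); case: (side u); case: (side w); case: (odd _).
- by apply: connect_trans cz; apply: connect1; rewrite /= euw uF.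
Qed.

(** On a path of odd length, parity makes the walk of shared vertices lead from [a] to [c] avoiding
    [b] and [d], or from [b] to [d] avoiding [a] and [c]; both contradict [good]. *)
Lemma good_even_pair a b c d x y :
  edge_pair root_adj side a b c d -> inc a x -> inc b x -> inc c y -> inc d y ->
  strant x y -> good root_adj a b c d -> even_pair x y.
Proof.
move=> pr ax bx cy dy sxy gd; split=> // p [hp [hd [lst pn]]].
apply/negP => op; have /andP[xy nxy] := strant_adj sxy.
case: p pn hd lst hp op => [//|x' [|x1 s]] _ /= ->; first by move=> yx; rewrite yx eqxx in xy.
rewrite /path_length /= => lst hp /negPn/negP ev; set P := [:: x, x1 & s] in hp *.
have hadj : path (@adj T) x (x1 :: s).
  by apply/(pathP x) => i ip; apply: (path_nth_adj x hp).
have ndis i j v : i.+1 < j -> j < (size s).+2 -> inc v (nth x P i) -> inc v (nth x P j) -> False.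
  move=> ij jp vi vj; have [UP _] := hp; have ip : i < size P := ltn_trans (ltnW ij) jp.
  have nij : nth x P i != nth x P j by rewrite nth_uniq // (ltn_eqF (ltnW ij)).
  have /negP[] : ~~ adj (nth x P i) (nth x P j).
    by apply: path_nth_nadj => //; rewrite nth_last /= lst.
  by apply/(adj_inc nij); exists v.
have xx1 : adj x x1 by case/andP: hadj.
have [u [ux ux1]] := adj_inc (adj_neq xx1) xx1.
wlog ua : a b c d pr ax bx cy dy gd / u = a => [hw|].
  have [ab cd acs /andP[ac bd]] := pr.
  have pr' : edge_pair root_adj side b a d c.
    split; rewrite ?(root_adj_sym _ a) ?(root_adj_sym _ c) ?bd ?ac //.
    by move: (root_adj_side ab) (root_adj_side cd) acs; case: (side a); case: (side b);
      case: (side c); case: (side d).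
  have aneb : a != b by case/andP: ab.
  have [ua|ub] := inc3 ax bx ux aneb; first exact: (hw a b c d).
  by apply: (hw b a d c) => //; rewrite /good andbC.
subst u; have /andP[/negP ngd _] := gd; apply: ngd.
have [ab cd acs /andP[ac bd]] := pr.
have [aneb cned] : a != b /\ c != d by case/andP: ab; case/andP: cd.
have zc v : inc v y -> side v = side a (+) odd (size s) -> v = c.
  rewrite (negPf ev) addbF acs => zy sz; exact: inc_side zy cy sz.
have hF0 : path (fun x y => ~~ has (fun v => inc v x && inc v y) [::]) x (x1 :: s).
  by apply/(pathP x).
(* With nothing to avoid, the walk shows that the last two vertices of the path share [c]; this is
   what prevents them from sharing [d] below. *)
have [z [zi zl sz _]] := @shared_vertex_walk [::] x x x1 s a hadj hF0 ndis ax ux1.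
rewrite lst in zl; have {sz zl}ez := zc z zl sz; subst z.
have hF : path (fun x y => ~~ has (fun v => inc v x && inc v y) [:: b; d]) x (x1 :: s).
  apply/(pathP x) => i ip; rewrite /= orbF negb_or; apply/andP; split; apply/negP => /andP[v1 v2].
    case: i ip v1 v2 => [|i] ip v1 v2; last exact: (ndis 0 i.+2 b).
    by move: (adj_neq xx1); rewrite (inc_inj aneb ax bx ux1 v2) eqxx.
  move: ip; rewrite /= ltnS leq_eqVlt => /orP[/eqP ei|ip]; last first.
    apply: (ndis i (size s).+1 d) => //.
    by rewrite -[(size s).+1]/(size P).-1 nth_last /= lst.
  have yl : nth x (x1 :: s) i = y by rewrite ei -[size s]/(size (x1 :: s)).-1 nth_last.
  rewrite yl in v2; rewrite -ei in zi.
  have ai : adj (nth x P i) y by rewrite -yl; apply: (pathP x hadj); rewrite ei.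
  by case/negP: (adj_neq ai); apply/eqP; apply: (inc_inj cned zi v1 cy dy).
have [z [_ zl sz]] := @shared_vertex_walk [:: b; d] x x x1 s a hadj hF ndis ax ux1.
by rewrite lst in zl; rewrite (zc z zl sz).
Qed.

(** * Thetas of the root graph and prisms *)

Definition strand t0 p q A (es : seq T) :=
  [/\ size es = (size A).+1, uniq es,
      forall x v, x \in es -> inc v x -> v \in p :: rcons A q,
      forall x, x \in es -> (inc p x = (x == head t0 es)) * (inc q x = (x == last t0 es)) &
      forall x y, x \in es -> y \in es -> x != y -> adj x y = consec_in es x y].

Lemma path_edges t0 u l : path root_adj u l ->
  exists2 es : seq T, size es = size l & forall k, k < size l ->
    inc (nth u (u :: l) k) (nth t0 es k) /\ inc (nth u l k) (nth t0 es k).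
Proof.
elim: l u => [|v l IHl] u /=; first by exists [::].
case/andP=> /root_adjP[_ [t [ut vt]]] /IHl[es szes hes].
exists (t :: es) => [|[|k] kl]; rewrite /= ?szes //.
have [h1 h2] := hes k kl; split.
- by rewrite (set_nth_default v) //= ltnW.
- by rewrite (set_nth_default v).
Qed.

(** Listed in the order of the path, the [k]-th edge has exactly the vertices of index [k] and
    [k.+1] as ends, so edges meet when their indices are consecutive. *)
Lemma strand_exists t0 p q A :
  path root_adj p (rcons A q) -> uniq (p :: rcons A q) ->
  exists es, strand t0 p q A es.
Proof.
move=> hp U; have [es szes hes] := path_edges t0 hp; exists es.
rewrite size_rcons in szes hes; set L := p :: rcons A q in U *.
have szL : size L = (size A).+2 by rewrite /= size_rcons.
have ends k v : k < size es -> inc v (nth t0 es k) ->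
    exists i, [/\ i < size L, v = nth p L i & (i == k) || (i == k.+1)].
  rewrite szes => ks vk; have [h1 h2] := hes k ks.
  have nn : nth p L k != nth p L k.+1.
    by rewrite nth_uniq ?szL // ?(ltn_eqF (ltnSn k)) // ltnW.
  have [->|->] := inc3 h1 h2 vk nn; [exists k | exists k.+1];
    by split; rewrite ?szL ?eqxx ?orbT // ltnW.
have incE k i : k < size es -> i < size L ->
    inc (nth p L i) (nth t0 es k) = (i == k) || (i == k.+1).
  move=> ks iL; apply/idP/idP => [/(ends k _ ks)[j [jL /eqP]]|].
    by rewrite nth_uniq // => /eqP->.
  by rewrite szes in ks; have [h1 h2] := hes k ks; case/orP=> /eqP->.
have ltL k : k < size es -> k < size L by rewrite szes szL => /leq_trans->.
have Ues : uniq es.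
  apply/(uniqP t0) => k l; rewrite !inE => ks ls ekl.
  have := incE k k ks (ltL k ks); rewrite ekl incE ?ltL // eqxx.
  have := incE l l ls (ltL l ls); rewrite -ekl incE ?ltL // eqxx.
  by clear; lia.
split=> //.
- by move=> x v /(nthP t0)[k ks <-] /(ends k _ ks)[i [iL -> _]]; apply: mem_nth.
- move=> x /(nthP t0)[k ks <-].
  have [es0 esl] : 0 < size es /\ (size es).-1 < size es by rewrite szes.
  split.
    have -> : inc p (nth t0 es k) = _ := incE k 0 ks isT.
    by rewrite -nth0 nth_uniq //; case: (k).
  have -> : q = nth p L (size A).+1 by rewrite /= nth_rcons ltnn eqxx.
  rewrite incE ?szL // -nth_last nth_uniq // szes /= eqSS [RHS]eq_sym.
  by rewrite gtn_eqF // -szes.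
- move=> _ _ /(nthP t0)[k ks <-] /(nthP t0)[l ls <-] nkl.
  rewrite /consec_in !mem_nth //= !index_uniq // /nat_consec.
  apply/(adj_inc nkl)/idP => [[v [vk vl]]|].
    have [i [iL ev ik]] := ends k v ks vk.
    have kl : k != l by apply: contraNneq nkl => ->.
    have [j [jL ev' jl]] := ends l v ls vl; move: ev' ik jl kl; rewrite ev => /eqP.
    by rewrite nth_uniq //; clear; lia.
  case/orP=> /eqP ekl.
    by exists (nth p L l); rewrite !incE ?ltL // -ekl !eqxx ?orbT.
  by exists (nth p L k); rewrite !incE ?ltL // -ekl !eqxx ?orbT.
Qed.

(** No edge joins [p] and [q], as they lie on one side. So the two paths have no common edge, and
    their edges can only meet at [p] or at [q]. *)
Lemma strands_adj t0 p q A B es es' x y :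
  side p = side q -> uniq (p :: q :: A ++ B) ->
  strand t0 p q A es -> strand t0 p q B es' -> x \in es -> y \in es' ->
  (x != y) * (adj x y = (x == head t0 es) && (y == head t0 es')
                     || (x == last t0 es) && (y == last t0 es')).
Proof.
move=> spq U [_ _ inA endA _] [_ _ inB endB _] xs ys.
have common v : inc v x -> inc v y -> v = p \/ v = q.
  move=> vx vy; have := inA x v xs vx; have := inB y v ys vy.
  rewrite !inE !mem_rcons !inE => /or3P[/eqP ?|/eqP ?|vB] /or3P[/eqP ?|/eqP ?|vA]; auto.
  have : uniq (A ++ B) by uniq_from U.
  by rewrite cat_uniq => /and3P[_ /hasP[]]; exists v.
have xy : x != y.
  apply/eqP => exy; subst y; have lr : lv x != rv x by [].
  have l1 : inc (lv x) x by rewrite /inc eqxx.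
  have r1 : inc (rv x) x by rewrite /inc eqxx orbT.
  have spl : side (lv x) != side (rv x) by [].
  by have [e1|e1] := common _ l1 l1; have [e2|e2] := common _ r1 r1;
    rewrite e1 e2 ?spq eqxx in spl.
split=> //; have [hx lx] := endA x xs; have [hy ly] := endB y ys.
rewrite -hx -hy -lx -ly; apply/(adj_inc xy)/idP => [[v [vx vy]]|].
  by have [ev|ev] := common v vx vy; rewrite -ev vx vy ?orbT.
by case/orP=> /andP[vx vy]; [exists p | exists q].
Qed.

(** Each path of the theta has an even number of edges, hence odd length as a path of [T]. The edges
    at [p] and those at [q] are the two triangles. *)
Lemma odd_theta_prism p q A R S :
  is_theta root_adj p q A R S -> side p = side q -> has_odd_prism T.
Proof.
move=> [hA hR hS U] spq.
have [t0 _] : exists t : T, true.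
  case: (A) hA => [|a A'] /andP[/root_adjP[_ [t _]] _]; by exists t.
have [P1 s1] : exists P, strand t0 p q A P by apply: strand_exists => //; uniq_from U.
have [P2 s2] : exists P, strand t0 p q R P by apply: strand_exists => //; uniq_from U.
have [P3 s3] : exists P, strand t0 p q S P by apply: strand_exists => //; uniq_from U.
have oddP B : path root_adj p (rcons B q) -> odd (size B).
  move=> hB; have := sorted_side root_adj_side (hB : sorted root_adj (p :: rcons B q)).
  by rewrite spq; case: (side q); case: (odd _).
(* An odd interior is nonempty, so every strand has at least two edges. *)
have form B P : strand t0 p q B P -> path root_adj p (rcons B q) ->
    exists a r b, P = a :: rcons r b.
  case=> szP _ _ _ _ /oddP oB; case: P szP => // a P [].
  by case/lastP: P => [|r b] szP; [rewrite -szP in oB | exists a, r, b].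
have [a1 [q1 [b1 e1]]] := form _ _ s1 hA.
have [a2 [q2 [b2 e2]]] := form _ _ s2 hR.
have [a3 [q3 [b3 e3]]] := form _ _ s3 hS.
exists a1, a2, a3, b1, b2, b3, q1, q2, q3; rewrite -e1 -e2 -e3 /path_length.
have hd1 : head t0 P1 = a1 by rewrite e1.
have hd2 : head t0 P2 = a2 by rewrite e2.
have hd3 : head t0 P3 = a3 by rewrite e3.
have la1 : last t0 P1 = b1 by rewrite e1 /= last_rcons.
have la2 : last t0 P2 = b2 by rewrite e2 /= last_rcons.
have la3 : last t0 P3 = b3 by rewrite e3 /= last_rcons.
have c12 x y (h1 : x \in P1) (h2 : y \in P2) :
    (x != y) * (adj x y = (x == a1) && (y == a2) || (x == b1) && (y == b2)).
  by rewrite -hd1 -hd2 -la1 -la2; apply: strands_adj spq _ s1 s2 h1 h2; uniq_from U.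
have c13 x y (h1 : x \in P1) (h2 : y \in P3) :
    (x != y) * (adj x y = (x == a1) && (y == a3) || (x == b1) && (y == b3)).
  by rewrite -hd1 -hd3 -la1 -la3; apply: strands_adj spq _ s1 s3 h1 h2; uniq_from U.
have c23 x y (h1 : x \in P2) (h2 : y \in P3) :
    (x != y) * (adj x y = (x == a2) && (y == a3) || (x == b2) && (y == b3)).
  by rewrite -hd2 -hd3 -la2 -la3; apply: strands_adj spq _ s2 s3 h1 h2; uniq_from U.
have [a1P a2P a3P] : [/\ a1 \in P1, a2 \in P2 & a3 \in P3].
  by rewrite e1 e2 e3 !mem_head.
have [b1P b2P b3P] : [/\ b1 \in P1, b2 \in P2 & b3 \in P3].
  by rewrite e1 e2 e3 !inE !mem_rcons !mem_head !orbT.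
have in1 x : x \in P1 -> [/\ (x \in [:: a1; a2; a3]) = (x == a1),
    (x \in [:: b1; b2; b3]) = (x == b1), x \in P2 = false & x \in P3 = false].
  move=> xP; have n2 y : y \in P2 -> (x == y) = false by move/(c12 x y xP) => -[/negPf].
  have n3 y : y \in P3 -> (x == y) = false by move/(c13 x y xP) => -[/negPf].
  rewrite !inE !(n2 a2, n2 b2, n3 a3, n3 b3) // !orbF; split=> //; apply/negP => h.
    by have := n2 x h; rewrite eqxx.
  by have := n3 x h; rewrite eqxx.
have in2 x : x \in P2 -> [/\ (x \in [:: a1; a2; a3]) = (x == a2),
    (x \in [:: b1; b2; b3]) = (x == b2), x \in P1 = false & x \in P3 = false].
  move=> xP; have n2 y : y \in P1 -> (x == y) = false.
    by move=> yP; have [/negPf] := c12 y x yP xP; rewrite eq_sym.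
  have n3 y : y \in P3 -> (x == y) = false by move/(c23 x y xP) => -[/negPf].
  rewrite !inE !(n2 a1, n2 b1, n3 a3, n3 b3) // !orbF; split=> //; apply/negP => h.
    by have := n2 x h; rewrite eqxx.
  by have := n3 x h; rewrite eqxx.
have in3 x : x \in P3 -> [/\ (x \in [:: a1; a2; a3]) = (x == a3),
    (x \in [:: b1; b2; b3]) = (x == b3), x \in P1 = false & x \in P2 = false].
  move=> xP; have n2 y : y \in P1 -> (x == y) = false.
    by move=> yP; have [/negPf] := c13 y x yP xP; rewrite eq_sym.
  have n3 y : y \in P2 -> (x == y) = false.
    by move=> yP; have [/negPf] := c23 y x yP xP; rewrite eq_sym.
  rewrite !inE !(n2 a1, n2 b1, n3 a2, n3 b2) //= ; split=> //; apply/negP => h.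
    by have := n2 x h; rewrite eqxx.
  by have := n3 x h; rewrite eqxx.
have [sz1 U1 _ _ ad1] := s1; have [sz2 U2 _ _ ad2] := s2; have [sz3 U3 _ _ ad3] := s3.
split; last by rewrite sz1 sz2 sz3 !oddP.
- rewrite !cat_uniq U1 U2 U3 !andbT /=; apply/andP; split; apply/hasP => -[x].
    by rewrite mem_cat => /orP[/in2|/in3] [_ _ ->].
  by move=> /in3[_ _ _ ->].
move=> x y; rewrite !mem_cat => xX yX xy.
have ne z : ((x == z) && (y == z)) = false.
  by apply: contraNF xy => /andP[/eqP-> /eqP->].
rewrite /consec_in.
case/or3P: xX => xP; case/or3P: yX => yP.
- by have [-> -> -> ->] := in1 x xP; have [-> -> _ _] := in1 y yP; rewrite !ne /= !orbF ad1.
- by have [-> -> -> ->] := in1 x xP; have [-> -> -> _] := in2 y yP;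
    rewrite ?xP ?yP /= ?andbF ?orbF c12.
- by have [-> -> -> ->] := in1 x xP; have [-> -> -> _] := in3 y yP;
    rewrite ?xP ?yP /= ?andbF ?orbF c13.
- have [-> -> -> ->] := in2 x xP; have [-> -> -> _] := in1 y yP.
  by rewrite ?xP ?yP /= ?andbF ?orbF adjC c12 // (andbC (x == a2)) (andbC (x == b2)).
- by have [-> -> -> ->] := in2 x xP; have [-> -> _ _] := in2 y yP; rewrite !ne /= !orbF ad2.
- by have [-> -> -> ->] := in2 x xP; have [-> -> _ ->] := in3 y yP;
    rewrite ?xP ?yP /= ?andbF ?orbF c23.
- have [-> -> -> ->] := in3 x xP; have [-> -> _ ->] := in1 y yP.
  by rewrite ?xP ?yP /= ?andbF ?orbF adjC c13 // (andbC (x == a3)) (andbC (x == b3)).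
- have [-> -> -> ->] := in3 x xP; have [-> -> _ ->] := in2 y yP.
  by rewrite ?xP ?yP /= ?andbF ?orbF adjC c23 // (andbC (x == a3)) (andbC (x == b3)).
- by have [-> -> -> ->] := in3 x xP; have [-> -> _ _] := in3 y yP; rewrite !ne /= ?orbF ad3.
Qed.

(** * Vertices where switchable pairs meet *)

Definition switch : pred ('I_n + 'I_m) :=
  fun w => [exists x, exists y, [&& semiadj x y, inc w x & inc w y]].

Lemma switchP w :
  reflect (exists x y, [/\ semiadj x y, inc w x & inc w y]) (w \in switch).
Proof.
apply: (iffP existsP) => [[x /existsP[y /and3P[]]]|[x [y [sxy wx wy]]]].
  by exists x, y.
by exists x; apply/existsP; exists y; rewrite sxy wx.
Qed.

Lemma semiadj_adj x y : semiadj x y -> adj x y.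
Proof. by rewrite /semiadj /adj; case: (x != y) => //=; case: theta. Qed.

Lemma semiadj_neq x y : semiadj x y -> x != y.
Proof. by case/andP. Qed.

Lemma semiadjC x y : semiadj x y = semiadj y x.
Proof. by rewrite /semiadj eq_sym theta_sym. Qed.

Lemma semiadj_only w x y z :
  semiadj x y -> inc w x -> inc w y -> inc w z -> z = x \/ z = y.
Proof.
move=> sxy wx wy wz; have [->|zx] := eqVneq z x; first by left.
have [->|zy] := eqVneq z y; first by right.
have := star3_stradj wx wy wz (semiadj_neq sxy); rewrite ![_ == z]eq_sym => /(_ zy zx).
by move: sxy; rewrite /semiadj /stradj; case: (x != y) => //=; case: theta.
Qed.

(** Only the two members of the switchable pair are edges at [w], so two of the three neighbours
    come from the same edge. *)
Lemma switch_deg w u1 u2 u3 : w \in switch ->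
  root_adj w u1 -> root_adj w u2 -> root_adj w u3 -> ~~ uniq [:: u1; u2; u3].
Proof.
case/switchP=> x [y [sxy wx wy]] /root_adjP[n1 [t1 [w1 i1]]]
  /root_adjP[n2 [t2 [w2 i2]]] /root_adjP[n3 [t3 [w3 i3]]].
have same t u u' : inc w t -> inc u t -> inc u' t -> w != u -> w != u' -> u = u'.
  move=> wt ut u't wu wu'; have [e'|->//] := inc3 wt ut u't wu.
  by rewrite e' eqxx in wu'.
rewrite /= !inE !andbT -negb_or negbK.
have [e1|e1] := semiadj_only sxy wx wy w1; have [e2|e2] := semiadj_only sxy wx wy w2;
  have [e3|e3] := semiadj_only sxy wx wy w3; subst t1 t2 t3;
  do [by rewrite (same _ _ _ w1 i1 i2) ?eqxx ?orbT
     |by rewrite (same _ _ _ w1 i1 i3) ?eqxx ?orbT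
     |by rewrite (same _ _ _ w2 i2 i3) ?eqxx ?orbT].
Qed.

Lemma switch_Dset w x : w \in switch -> inc w x -> x \in Dset T.
Proof.
case/switchP=> y [z [syz wy wz]] wx; rewrite inE /sw.
by have [->|->] := semiadj_only syz wy wz wx; apply/existsP;
  [exists z | exists y; rewrite semiadjC].
Qed.

Lemma Dset_switch x : x \in Dset T -> exists2 w, w \in switch & inc w x.
Proof.
rewrite inE => /existsP[y sxy]; have axy := semiadj_adj sxy.
have [w [wx wy]] := adj_inc (adj_neq axy) axy.
by exists w => //; apply/switchP; exists x, y.
Qed.

Hypothesis one_swcomp : forall C C' : {set T}, swcomp C -> swcomp C' -> C = C'.
Hypothesis two_sw_edges : forall C : {set T}, swcomp C -> #|sw_edges C| <= 2.

(** Both pairs lie in the only switchable component. If they were disjoint, connecting them would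
    take a third switchable pair leaving [{x, y}]. *)
Lemma semi_pairs_meet x y x' y' : semiadj x y -> semiadj x' y' ->
  (x' \in [set x; y]) || (y' \in [set x; y]).
Proof.
move=> sxy sxy'; have comp t t' : semiadj t t' -> swcomp [set z | connect (@sw T) t z].
  move=> stt'; split; first by exists t.
  rewrite (cardsD1 t) (cardsD1 t') !inE connect0 (connect1 (stt' : sw t t')).
  by rewrite eq_sym (semiadj_neq stt').
have cx := comp _ _ sxy; have eC := one_swcomp cx (comp _ _ sxy').
have cxx' : connect (@sw T) x x'.
  by have : x' \in [set z | connect (@sw T) x' z] by [rewrite inE]; rewrite -eC inE.
apply: contraTT cxx' => /norP[nx' ny'].
apply: (closed_disconnected (P := mem [set x; y])); [|exact: set21|exact: nx'].
move=> u v /= uP suv; apply/negPn/negP => vP.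
have sub : [set [set x; y]; [set x'; y']; [set u; v]]
    \subset sw_edges [set z | connect (@sw T) x z].
  have memE t t' : semiadj t t' -> connect (@sw T) x t ->
      [set t; t'] \in sw_edges [set z | connect (@sw T) x z].
    move=> stt' ct; rewrite inE; apply/existsP; exists t; rewrite inE ct.
    by apply/existsP; exists t'; rewrite [sw _ _]stt' eqxx.
  apply/subsetP => E; rewrite !in_setU !in_set1 -orbA => /or3P[]/eqP->; apply: memE => //.
    by have : x' \in [set z | connect (@sw T) x' z] by [rewrite inE]; rewrite -eC inE.
  by move: uP; rewrite !inE => /orP[]/eqP->; rewrite ?connect0 ?connect1.
have := leq_trans (subset_leq_card sub) (two_sw_edges cx).
rewrite -setUA cardsU1 cards2 in_set2 negb_or.
have uN : u \notin [set x'; y'].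
  apply/negP => uN; move: uP uN nx' ny'; rewrite !inE.
  by move=> /orP[]/eqP-> /orP[]/eqP->; rewrite eqxx ?orbT.
have -> : [set x; y] != [set x'; y'].
  by apply: contraNneq nx' => ->; rewrite set21.
have -> : [set x; y] != [set u; v].
  by apply: contraNneq vP => ->; rewrite set22.
have -> : [set x'; y'] != [set u; v].
  by apply: contraNneq uN => ->; rewrite set21.
by [].
Qed.

(** The vertex of [T] common to the two switchable pairs is an edge with ends [w] and [w']. *)
Lemma switch_adj w w' : w \in switch -> w' \in switch -> w != w' -> root_adj w w'.
Proof.
move=> /switchP[x [y [sxy wx wy]]] /switchP[x' [y' [sxy' wx' wy']]] ww'.
have common t : inc w' t -> t \in [set x; y] -> root_adj w w'.
  by move=> w't; rewrite !inE => /orP[]/eqP et; rewrite {}et in w't;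
    [apply: edge_ends wx w't | apply: edge_ends wy w't].
by have /orP[] := semi_pairs_meet sxy sxy'; apply: common.
Qed.

(** * Even pairs from good pairs *)

Hypothesis no_odd_prism : ~ has_odd_prism T.

Lemma root_theta_side p q A R S : is_theta root_adj p q A R S -> side p != side q.
Proof. by move=> th; apply/eqP => spq; apply/no_odd_prism/(odd_theta_prism th). Qed.

Lemma good_pair_even_pair (W : {pred 'I_n + 'I_m}) : good_pair_avoid root_adj side W ->
  exists x y, even_pair x y /\ forall v, inc v x || inc v y -> v \notin W.
Proof.
case=> a [b [c [d [pr gd /and5P[aW bW cW dW _]]]]].
have [x [y [[ax bx cy dy] sxy]]] := edge_pairE pr.
have /and4P[] := edge_pair_uniq root_adj_side pr.
rewrite !inE !negb_or => /and3P[ab _ _] _ cd _.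
exists x, y; split; first exact: good_even_pair pr ax bx cy dy sxy gd.
by move=> v /orP[vx|vy]; [have [->|->] := inc3 ax bx vx ab | have [->|->] := inc3 cy dy vy cd].
Qed.

(** The position of the even pair does not matter here, so [W] is taken empty. *)
Lemma nonadj_even_pair x y : x != y -> ~~ adj x y -> exists x' y' : T, even_pair x' y'.
Proof.
move=> xy nxy; have pr := edge_pair_of xy nxy.
have := @good_pair_W0 _ _ _ root_adj_sym root_adj_side root_theta_side pred0 _ _ _ _ _ _ pr.
case/(_ _ _ _)/good_pair_even_pair => // x' [y' [ev _]]; by exists x', y'.
Qed.

Lemma all_notin_W x y (W : {pred 'I_n + 'I_m}) :
  (forall v, inc v x || inc v y -> v \notin W) ->
  all [predC W] [:: lv x; rv x; lv y; rv y].
Proof. by move=> h; apply/and5P; split=> //; apply: h; rewrite /inc !eqxx ?orbT. Qed.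

(** The cases are the possible numbers of vertices in [switch]: at most two, since they are pairwise
    adjacent in a bipartite graph. *)
Lemma favorable_even_pair : favorable T ->
  exists u v : T, [/\ even_pair u v, u \notin Dset T & v \notin Dset T].
Proof.
move=> [_ [u [v /and3P[suv uD vD]]] fav3].
suff /good_pair_even_pair[x [y [ev h]]] : good_pair_avoid root_adj side switch.
  by exists x, y; split=> //; apply/negP => /Dset_switch[w wW wi];
    have := h w; rewrite wW wi ?orbT => /(_ isT).
have avoid t w : t \notin Dset T -> inc w t -> w \notin switch.
  by move=> tD wt; apply: contra tD => /switch_Dset; apply.
have /andP[uv nuv] := strant_adj suv; have pr := edge_pair_of uv nuv.
have hW : all [predC switch] [:: lv u; rv u; lv v; rv v].
  by apply: all_notin_W => w /orP[/(avoid _ _ uD)|/(avoid _ _ vD)].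
have [/existsP[w wW]|noW] := boolP [exists w, w \in switch]; last first.
  apply: (good_pair_W0 root_adj_sym root_adj_side root_theta_side switch_deg switch_adj pr).
  move=> w; rewrite [RHS]inE; apply/negbTE; apply: contra noW => wW.
  by apply/existsP; exists w.
have [/existsP[w' /andP[w'W w'w]]|noW'] := boolP [exists w', (w' \in switch) && (w' != w)].
  have ww' : root_adj w w' by apply: switch_adj; rewrite // eq_sym.
  have [s Nw] := W_two_nbrs switch_deg wW ww'.
  have w'w_adj : root_adj w' w by rewrite root_adj_sym.
  have [t Nw'] := W_two_nbrs switch_deg w'W w'w_adj.
  apply: (good_pair_W2 root_adj_sym root_adj_side root_theta_side switch_deg switch_adj
    ww' Nw Nw' _ pr hW).
  move=> z; rewrite !inE; apply/idP/orP => [zW|[]/eqP-> //].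
  have [_|zw] := eqVneq z w; first by left.
  have [_|zw'] := eqVneq z w'; first by right.
  have := root_adj_side (switch_adj zW wW zw); have := root_adj_side (switch_adj zW w'W zw').
  by move: (root_adj_side ww'); case: (side z); case: (side w); case: (side w').
have W1 : switch =i pred1 w.
  move=> z; rewrite inE; apply/idP/eqP => [zW|-> //].
  by apply/eqP; apply: contraNT noW' => zw; apply/existsP; exists z; rewrite zW.
have /switchP[x [y [sxy wx wy]]] := wW.
have eqD : Dset T = [set x; y].
  apply/setP => z; apply/idP/idP => [/Dset_switch[w'']|].
    rewrite W1 => /eqP-> wz; have [->|->] := semiadj_only sxy wx wy wz; by rewrite !inE eqxx ?orbT.
  by rewrite in_set2 => /orP[]/eqP->; apply: switch_Dset wW _.
have other t : inc w t -> exists2 s, w != s & inc s t.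
  by case/orP=> /eqP->; [exists (rv t) | exists (lv t)]; rewrite // /inc eqxx ?orbT.
have nbrs r s u' : w != r -> inc r x -> w != s -> inc s y -> root_adj w u' ->
    u' = r \/ u' = s.
  move=> wr rx ws sy /root_adjP[wu [z [wz uz]]].
  have [ez|ez] := semiadj_only sxy wx wy wz; subst z.
    by have [eu|] := inc3 wx rx uz wr; [rewrite eu eqxx in wu | left].
  by have [eu|] := inc3 wy sy uz ws; [rewrite eu eqxx in wu | right].
have [r wr rx] := other x wx; have [s ws sy] := other y wy.
(* With [q] the end of [z] other than [w], nonadjacent vertices outside [Dset T] and [N z] are
   disjoint edges missing [w] and [q], as [good_pair_W1] requires. *)
have finish z q q' : inc w z -> w != q -> inc q z -> z \in Dset T ->
    (forall u', root_adj w u' -> u' = q' \/ u' = q) ->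
    ~ clique (~: (Dset T :|: N z)) -> good_pair_avoid root_adj side switch.
  move=> wz wq qz zD Nw ncl.
  have /existsP[e1 /existsP[e2 /and4P[h1 h2 e12 n12]]] : [exists e1, exists e2,
    [&& e1 \in ~: (Dset T :|: N z), e2 \in ~: (Dset T :|: N z), e1 != e2 & ~~ adj e1 e2]].
    apply: contraT => /existsPn no; case: ncl => e1 e2 h1 h2 e12.
    by move/existsPn: (no e1) => /(_ e2); rewrite h1 h2 e12 negbK.
  apply: (good_pair_W1 root_adj_sym root_adj_side root_theta_side switch_deg switch_adj
    (edge_ends wq wz qz) Nw W1 (edge_pair_of e12 n12)).
  have miss e0 v' : e0 \in ~: (Dset T :|: N z) -> inc v' e0 -> v' \notin [:: w; q].
    rewrite !inE negb_or => /andP[e0D e0z] v'e; rewrite negb_or; apply/andP; split.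
      apply: contraNneq e0D => ev; rewrite ev in v'e.
      by have := switch_Dset wW v'e; rewrite inE.
    apply: contraNneq e0z => ev; rewrite ev in v'e.
    have ze : z != e0 by apply: contraNneq e0D => <-; move: zD; rewrite inE.
    by apply/(adj_inc ze); exists q.
  by apply: (all_notin_W (W := mem [:: w; q])) => v' /orP[/(miss _ _ h1)|/(miss _ _ h2)].
have [xD yD] : x \in Dset T /\ y \in Dset T by rewrite eqD set21 set22.
case: (fav3 x y sxy eqD).
- by apply: (finish x r s) => // u' /(nbrs r s u' wr rx ws sy)[]; auto.
- by apply: (finish y s r) => // u' /(nbrs r s u' wr rx ws sy)[]; auto.
Qed.

End RootGraph.

Theorem theorem4p5 (T : trigraph) :
  line_trigraph T -> in_F T -> ~ has_odd_prism T ->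
  (complete T \/ exists u v : T, even_pair u v) /\
  (favorable T ->
     exists u v : T, [/\ even_pair u v, u \notin Dset T & v \notin Dset T]).
Proof.
move=> [[n [m [e [e_inj e_adj]]]] strong3] [_ one two _ _] noprism; split; last first.
  exact: (favorable_even_pair e_inj e_adj strong3 one two noprism).
have [/existsP[u /existsP[v /andP[uv nuv]]]|no] :=
    boolP [exists u : T, exists v : T, (u != v) && ~~ adj u v].
  by right; apply: (nonadj_even_pair e_inj e_adj strong3 noprism uv nuv).
left=> u v _ _ uv; apply: contraNT no => nuv.
by apply/existsP; exists u; apply/existsP; exists v; rewrite uv.
Qed.
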